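(* Let $R$ be a ring and let $Q=Q^{\sigma}_{\mathrm{max}}(R)$ be its maximal symmetric ring of quotients. If $\gamma$ is an ordinal for which $Q^{(\gamma)}=Q^{(\gamma+1)}$ (and such an ordinal exists), then $Q^{\sigma}_{\mathrm{tot}}(R)=Q^{(\gamma)}$.
   Context: Rings are associative with identity. $Q^{\sigma}_{\mathrm{max}}(R)$, the maximal symmetric ring of quotients: the ring of equivalence classes of pairs $(a,b)$, where $a:I\to R$ is a left $R$-homomorphism from a dense left ideal $I$, $b:J\to R$ is a right $R$-homomorphism from a dense right ideal $J$, and $a(i)j=ib(j)$ for all $i\in I$, $j\in J$; two pairs are equivalent if their first components agree on some dense left ideal and their second components agree on some dense right ideal; addition is componentwise and $[(a_1,b_1)][(a_2,b_2)]=[(a_2\circ a_1,b_1\circ b_2)]$ on suitable smaller dense ideals. $R$ embeds in it via $r\mapsto$ (right multiplication by $r$, left multiplication by $r$). For a ring extension $S$ of $R$ (i.e. $R$ is a subring of $S$ with the same identity) and $s\in S$, put $(R:s)=\{x\in R\mid xs\in R\}$ and $(s:R)=\{x\in R\mid sx\in R\}$, and define $$S'=\{s\in S\mid S(R:rs)=S\text{ and }(sr:R)S=S\text{ for every }r\in R\}.$$ $S'$ is a subring of $S$ containing $R$. Define $S^{(0)}=S$, $S^{(\alpha+1)}=(S^{(\alpha)})'$, and $S^{(\alpha)}=\bigcap_{\beta<\alpha}S^{(\beta)}$ for $\alpha$ a limit ordinal. $Q^{\sigma}_{\mathrm{tot}}(R)$, the total symmetric ring of quotients: the largest subring $S$ of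 $Q^{\sigma}_{\mathrm{max}}(R)$ containing $R$ such that the inclusion $R\subseteq S$ is an epimorphism in the category of rings and $S$ is flat both as a left and as a right $R$-module (such a largest subring exists). Every injective ring epimorphism $R\to S$ with $S$ left and right $R$-flat factors uniquely through $R\subseteq Q^{\sigma}_{\mathrm{tot}}(R)$ via a monomorphism. *)

(* Defs.v *)
From HB Require Import structures.
From mathcomp Require Import all_boot all_algebra.
From mathcomp Require Import boolp classical_sets.

Set Implicit Arguments.
Unset Strict Implicit.
Unset Printing Implicit Defensive.

Import GRing.Theory.

Local Open Scope ring_scope.
Local Open Scope classical_set_scope.
Local Open Scope quotient_scope.

(******************************************************************************)
(*  Rings are [pzRingType]s: associative with identity, the zero ring being   *)
(*  allowed.  Left R-modules are [lmodType R]; right R-modules are            *)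
(*  [lmodType R^c], so that [m] acted upon by [r] on the right is [r *: m].   *)
(******************************************************************************)

Section DenseIdeals.
Variable R : pzRingType.
Implicit Types I J : set R.

Definition left_ideal I :=
  [/\ I 0, forall x y, I x -> I y -> I (x + y)
    & forall r x, I x -> I (r * x)].

Definition right_ideal J :=
  [/\ J 0, forall x y, J x -> J y -> J (x + y)
    & forall r x, J x -> J (x * r)].

Definition dense_left_ideal I := left_ideal I /\
  forall x y, x <> 0 -> exists r, r * x <> 0 /\ I (r * y).

Definition dense_right_ideal J := right_ideal J /\
  forall x y, x <> 0 -> exists r, x * r <> 0 /\ J (y * r).

(* A homomorphism defined on an ideal is a total function on R of which only  *)
(* the values on the ideal matter.                                            *)
Definition left_hom_on I (a : R -> R) :=
  (forall x y, I x -> I y -> a (x + y) = a x + a y) /\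
  (forall r x, I x -> a (r * x) = r * a x).

Definition right_hom_on J (b : R -> R) :=
  (forall x y, J x -> J y -> b (x + y) = b x + b y) /\
  (forall r x, J x -> b (x * r) = b x * r).

Lemma dense_leftT : dense_left_ideal setT.
Proof. by split=> // x y x0; exists 1; rewrite mul1r. Qed.

Lemma dense_leftI I J : dense_left_ideal I -> dense_left_ideal J ->
  dense_left_ideal (I `&` J).
Proof.
move=> [[I0 ID IM] dI] [[J0 JD JM] dJ]; split.
  split=> //= [x y [? ?] [? ?]|r x [? ?]]; split; auto.
move=> x y x0; have [r [rx0 Iry]] := dI x y x0.
have [s [sx0 Jsy]] := dJ (r * x) (r * y) rx0.
by exists (s * r); rewrite -!mulrA; split=> //; split=> //; apply: IM.
Qed.

Lemma dense_left_preim I a J : dense_left_ideal I -> left_hom_on I a ->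
  dense_left_ideal J -> dense_left_ideal [set x | I x /\ J (a x)].
Proof.
move=> [[I0 ID IM] dI] [aD aM] [[J0 JD JM] dJ]; split.
  split=> /= [|x y [Ix Jx] [Iy Jy]|r x [Ix Jx]].
  - by split=> //; rewrite -[X in a X](mulr0 0) aM // mul0r.
  - by split; [exact: ID | rewrite aD //; exact: JD].
  - by split; [exact: IM | rewrite aM //; exact: JM].
move=> x y x0; have [r [rx0 Iry]] := dI x y x0.
have [s [sx0 Jsy]] := dJ (r * x) (a (r * y)) rx0.
exists (s * r); rewrite -!mulrA; split=> //.
by split; [exact: IM | rewrite aM].
Qed.

Lemma dense_left_faithful I x : dense_left_ideal I ->
  (forall i, I i -> i * x = 0) -> x = 0.
Proof.
move=> [_ dI] Ix; apply: contrapT => x0.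
by have [r [rx0 Ir]] := dI x 1 x0; apply: rx0; apply: Ix; rewrite -[r]mulr1.
Qed.

End DenseIdeals.

(* A right ideal of R is, by conversion, a left ideal of R^c.                 *)
Section DenseRightIdeals.
Variable R : pzRingType.
Implicit Types I J : set R.

Lemma dense_rightT : dense_right_ideal [set: R].
Proof. exact: (@dense_leftT R^c). Qed.

Lemma dense_rightI I J : dense_right_ideal I -> dense_right_ideal J ->
  dense_right_ideal (I `&` J).
Proof. exact: (@dense_leftI R^c). Qed.

Lemma dense_right_preim I b J : dense_right_ideal I -> right_hom_on I b ->
  dense_right_ideal J -> dense_right_ideal [set x | I x /\ J (b x)].
Proof. exact: (@dense_left_preim R^c). Qed.

Lemma dense_right_faithful I x : dense_right_ideal I ->
  (forall i, I i -> x * i = 0) -> x = 0.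
Proof. exact: (@dense_left_faithful R^c). Qed.

End DenseRightIdeals.

Record qpair (R : pzRingType) := QPair {
  qI : set R;
  qa : R -> R;
  qJ : set R;
  qb : R -> R;
  qI_dense : dense_left_ideal qI;
  qa_hom : left_hom_on qI qa;
  qJ_dense : dense_right_ideal qJ;
  qb_hom : right_hom_on qJ qb;
  qab : forall i j, qI i -> qJ j -> qa i * j = i * qb j }.

HB.instance Definition _ (R : pzRingType) := gen_eqMixin (qpair R).
HB.instance Definition _ (R : pzRingType) := gen_choiceMixin (qpair R).

Section Qmax.
Variable R : pzRingType.
Implicit Types p q : qpair R.

Definition qpair_eqv p q :=
  (exists K : set R, [/\ dense_left_ideal K, K `<=` qI p `&` qI q
     & forall x, K x -> qa p x = qa q x]) /\
  (exists L : set R, [/\ dense_right_ideal L, L `<=` qJ p `&` qJ q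
     & forall x, L x -> qb p x = qb q x]).

Definition qpair_rel p q : bool := `[< qpair_eqv p q >].

Lemma qpair_rel_refl : reflexive qpair_rel.
Proof.
move=> p; apply/asboolP; split; [exists (qI p)|exists (qJ p)]; split=> //.
- exact: qI_dense.
- exact: qJ_dense.
Qed.

Lemma qpair_rel_sym : symmetric qpair_rel.
Proof.
suff H p q : qpair_rel p q -> qpair_rel q p by move=> p q; apply/idP/idP; apply: H.
move=> /asboolP[[K [dK sK eK]] [L [dL sL eL]]]; apply/asboolP.
by split; [exists K|exists L]; split=> // x Kx;
  [case: (sK x Kx)| rewrite eK|case: (sL x Kx)| rewrite eL].
Qed.

Lemma qpair_rel_trans : transitive qpair_rel.
Proof.
move=> q p r /asboolP[[K [dK sK eK]] [L [dL sL eL]]].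
move=> /asboolP[[K' [dK' sK' eK']] [L' [dL' sL' eL']]]; apply/asboolP; split.
  exists (K `&` K'); split; first exact: dense_leftI.
    by move=> x [/sK[? _] /sK'[_ ?]].
  by move=> x [Kx K'x]; rewrite eK ?eK'.
exists (L `&` L'); split; first exact: dense_rightI.
  by move=> x [/sL[? _] /sL'[_ ?]].
by move=> x [Lx L'x]; rewrite eL ?eL'.
Qed.

Canonical qpair_equiv :=
  EquivRel qpair_rel qpair_rel_refl qpair_rel_sym qpair_rel_trans.

Definition Qmax := {eq_quot qpair_rel}.
HB.instance Definition _ := Choice.on Qmax.
HB.instance Definition _ := EqQuotient.on Qmax.

Lemma Qmax_eqP p q : qpair_eqv p q <-> \pi_Qmax p = \pi_Qmax q.
Proof.
split=> [h|/eqP]; first by apply/eqmodP/asboolP.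
by rewrite piE => /asboolP.
Qed.

(* It suffices to compare two pairs on the intersections of any two dense     *)
(* ideals contained in the domains.                                           *)
Lemma Qmax_eq (K L : set R) p q :
  dense_left_ideal K -> K `<=` qI p -> K `<=` qI q ->
  (forall x, K x -> qa p x = qa q x) ->
  dense_right_ideal L -> L `<=` qJ p -> L `<=` qJ q ->
  (forall x, L x -> qb p x = qb q x) -> \pi_Qmax p = \pi_Qmax q.
Proof.
move=> dK Kp Kq eK dL Lp Lq eL; apply/Qmax_eqP; split.
  by exists K; split=> // x Kx; split; auto.
by exists L; split=> // x Lx; split; auto.
Qed.

Definition qpair_add p q : qpair R.
Proof.
refine (@QPair R (qI p `&` qI q) (fun x => qa p x + qa q x)
                 (qJ p `&` qJ q) (fun x => qb p x + qb q x) _ _ _ _ _).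
- exact: dense_leftI (qI_dense p) (qI_dense q).
- have [pD pM] := qa_hom p; have [qD qM] := qa_hom q.
  split=> [x y [? ?] [? ?]|r x [? ?]]; first by rewrite pD // qD // addrACA.
  by rewrite pM // qM // mulrDr.
- exact: dense_rightI (qJ_dense p) (qJ_dense q).
- have [pD pM] := qb_hom p; have [qD qM] := qb_hom q.
  split=> [x y [? ?] [? ?]|r x [? ?]]; first by rewrite pD // qD // addrACA.
  by rewrite pM // qM // mulrDl.
- by move=> i j [? ?] [? ?]; rewrite mulrDl mulrDr !qab.
Defined.

Definition qpair_opp p : qpair R.
Proof.
refine (@QPair R (qI p) (fun x => - qa p x) (qJ p) (fun x => - qb p x) _ _ _ _ _).
- exact: qI_dense.
- have [pD pM] := qa_hom p.
  by split=> [x y ? ?|r x ?]; [rewrite pD // opprD | rewrite pM // mulrN].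
- exact: qJ_dense.
- have [pD pM] := qb_hom p.
  by split=> [x y ? ?|r x ?]; [rewrite pD // opprD | rewrite pM // mulNr].
- by move=> i j ? ?; rewrite mulNr mulrN qab.
Defined.

Definition qpair_mul p q : qpair R.
Proof.
refine (@QPair R [set i | qI p i /\ qI q (qa p i)] (qa q \o qa p)
                 [set j | qJ q j /\ qJ p (qb q j)] (qb p \o qb q) _ _ _ _ _).
- exact: dense_left_preim (qI_dense p) (qa_hom p) (qI_dense q).
- have [pD pM] := qa_hom p; have [qD qM] := qa_hom q.
  split=> [x y [? ?] [? ?]|r x [? ?]] /=; first by rewrite pD // qD.
  by rewrite pM // qM.
- exact: dense_right_preim (qJ_dense q) (qb_hom q) (qJ_dense p).
- have [pD pM] := qb_hom p; have [qD qM] := qb_hom q.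
  split=> [x y [? ?] [? ?]|r x [? ?]] /=; first by rewrite qD // pD.
  by rewrite qM // pM.
- by move=> i j [? ?] [? ?] /=; rewrite !qab.
Defined.

Definition qpair_of (r : R) : qpair R.
Proof.
refine (@QPair R setT (fun x => x * r) setT (fun x => r * x) _ _ _ _ _).
- exact: dense_leftT.
- by split=> [x y _ _|s x _]; rewrite ?mulrDl ?mulrA.
- exact: dense_rightT.
- by split=> [x y _ _|s x _]; rewrite ?mulrDr ?mulrA.
- by move=> i j _ _; rewrite mulrA.
Defined.

Definition Qmax_zero : Qmax := \pi_Qmax (qpair_of 0).
Definition Qmax_one : Qmax := \pi_Qmax (qpair_of 1).
Definition Qmax_add (u v : Qmax) : Qmax := \pi_Qmax (qpair_add (repr u) (repr v)).
Definition Qmax_opp (u : Qmax) : Qmax := \pi_Qmax (qpair_opp (repr u)).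
Definition Qmax_mul (u v : Qmax) : Qmax := \pi_Qmax (qpair_mul (repr u) (repr v)).

Lemma repr_eqv p : qpair_eqv (repr (\pi_Qmax p)) p.
Proof. by apply/Qmax_eqP; rewrite reprK. Qed.

Lemma Qmax_addE p q :
  Qmax_add (\pi_Qmax p) (\pi_Qmax q) = \pi_Qmax (qpair_add p q).
Proof.
rewrite /Qmax_add.
have [[K [dK sK eK]] [L [dL sL eL]]] := repr_eqv p.
have [[K' [dK' sK' eK']] [L' [dL' sL' eL']]] := repr_eqv q.
apply: (@Qmax_eq (K `&` K') (L `&` L')).
- exact: dense_leftI.
- by move=> x [/sK[? _] /sK'[? _]].
- by move=> x [/sK[_ ?] /sK'[_ ?]].
- by move=> x [Kx K'x] /=; rewrite eK // eK'.
- exact: dense_rightI.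
- by move=> x [/sL[? _] /sL'[? _]].
- by move=> x [/sL[_ ?] /sL'[_ ?]].
- by move=> x [Lx L'x] /=; rewrite eL // eL'.
Qed.

Lemma Qmax_oppE p : Qmax_opp (\pi_Qmax p) = \pi_Qmax (qpair_opp p).
Proof.
rewrite /Qmax_opp; have [[K [dK sK eK]] [L [dL sL eL]]] := repr_eqv p.
apply: (@Qmax_eq K L) => //= x; try by case/sK.
- by move=> Kx; rewrite eK.
- by case/sL.
- by case/sL.
- by move=> Lx; rewrite eL.
Qed.

Lemma left_hom_sub (I K : set R) a :
  K `<=` I -> left_hom_on I a -> left_hom_on K a.
Proof. by move=> sKI [aD aM]; split=> *; [apply: aD|apply: aM]; apply: sKI. Qed.

Lemma right_hom_sub (I K : set R) a :
  K `<=` I -> right_hom_on I a -> right_hom_on K a.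
Proof. by move=> sKI [aD aM]; split=> *; [apply: aD|apply: aM]; apply: sKI. Qed.

Lemma Qmax_mulE p q :
  Qmax_mul (\pi_Qmax p) (\pi_Qmax q) = \pi_Qmax (qpair_mul p q).
Proof.
rewrite /Qmax_mul.
have [[K [dK sK eK]] [L [dL sL eL]]] := repr_eqv p.
have [[K' [dK' sK' eK']] [L' [dL' sL' eL']]] := repr_eqv q.
apply: (@Qmax_eq [set x | K x /\ K' (qa p x)] [set x | L' x /\ L (qb q x)]).
- apply: dense_left_preim => //; apply: left_hom_sub (qa_hom p).
  by move=> x /sK[].
- by move=> x [Kx K'x]; split; [case: (sK x Kx)|rewrite eK //; case: (sK' _ K'x)].
- by move=> x [Kx K'x]; split; [case: (sK x Kx)|case: (sK' _ K'x)].
- by move=> x [Kx K'x] /=; rewrite eK // eK'.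
- apply: dense_right_preim => //; apply: right_hom_sub (qb_hom q).
  by move=> x /sL'[].
- by move=> x [Kx K'x]; split; [case: (sL' x Kx)|rewrite eL' //; case: (sL _ K'x)].
- by move=> x [Kx K'x]; split; [case: (sL' x Kx)|case: (sL _ K'x)].
- by move=> x [Kx K'x] /=; rewrite eL' // eL.
Qed.

(* When two pairs have pointwise equal components on a common dense ideal     *)
(* that is their whole domain.                                                *)
Lemma Qmax_eq_dom p q : qI p `<=` qI q -> qJ p `<=` qJ q ->
  (forall x, qI p x -> qa p x = qa q x) ->
  (forall x, qJ p x -> qb p x = qb q x) -> \pi_Qmax p = \pi_Qmax q.
Proof.
by move=> sI sJ eI eJ; apply: (@Qmax_eq (qI p) (qJ p)) => //;
  [exact: qI_dense | exact: qJ_dense].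
Qed.

Lemma Qmax_addA : associative Qmax_add.
Proof.
elim/quotW=> p; elim/quotW=> q; elim/quotW=> r.
rewrite (Qmax_addE q r) (Qmax_addE p q) !Qmax_addE.
by apply: Qmax_eq_dom => [x [? []]|x [? []]|x _|x _] //=; rewrite addrA.
Qed.

Lemma Qmax_addC : commutative Qmax_add.
Proof.
elim/quotW=> p; elim/quotW=> q; rewrite !Qmax_addE.
by apply: Qmax_eq_dom => [x []|x []|x _|x _] //=; rewrite addrC.
Qed.

Lemma Qmax_add0 : left_id Qmax_zero Qmax_add.
Proof.
elim/quotW=> p; rewrite /Qmax_zero !Qmax_addE.
by apply: Qmax_eq_dom => [x []|x []|x _|x _] //=; rewrite ?mulr0 ?mul0r add0r.
Qed.

Lemma Qmax_addN : left_inverse Qmax_zero Qmax_opp Qmax_add.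
Proof.
elim/quotW=> p; rewrite /Qmax_zero Qmax_oppE Qmax_addE.
by apply: Qmax_eq_dom => [x []|x []|x _|x _] //=; rewrite ?mulr0 ?mul0r addNr.
Qed.

HB.instance Definition _ :=
  GRing.isZmodule.Build Qmax Qmax_addA Qmax_addC Qmax_add0 Qmax_addN.

Lemma Qmax_mulA : associative Qmax_mul.
Proof.
elim/quotW=> p; elim/quotW=> q; elim/quotW=> r.
rewrite (Qmax_mulE q r) (Qmax_mulE p q) !Qmax_mulE.
by apply: Qmax_eq_dom => [x [? []]|x [[? ?] ?]|x _|x _].
Qed.

Lemma Qmax_mul1 : left_id Qmax_one Qmax_mul.
Proof.
elim/quotW=> p; rewrite /Qmax_one Qmax_mulE.
by apply: Qmax_eq_dom => [x [_]|x []|x _|x _] //=; rewrite ?mulr1 ?mul1r.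
Qed.

Lemma Qmax_mulr1 : right_id Qmax_one Qmax_mul.
Proof.
elim/quotW=> p; rewrite /Qmax_one Qmax_mulE.
by apply: Qmax_eq_dom => [x []|x [_]|x _|x _] //=; rewrite ?mulr1 ?mul1r.
Qed.

Lemma Qmax_mulDl : left_distributive Qmax_mul +%R.
Proof.
elim/quotW=> p; elim/quotW=> q; elim/quotW=> r.
rewrite [\pi_Qmax p + _]Qmax_addE (Qmax_mulE p r) (Qmax_mulE q r) !Qmax_mulE.
rewrite [RHS]Qmax_addE.
have [rD _] := qa_hom r; have [[_ _ _] _] := qI_dense r.
symmetry; apply: Qmax_eq_dom => /=.
- move=> x [[px rx] [qx r'x]]; split=> //.
  by have [[_ ID _] _] := qI_dense r; apply: ID.
- by move=> x [[px rx] [qx r'x]].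
- by move=> x [[px rx] [qx r'x]]; rewrite rD.
- by [].
Qed.

Lemma Qmax_mulDr : right_distributive Qmax_mul +%R.
Proof.
elim/quotW=> r; elim/quotW=> p; elim/quotW=> q.
rewrite [\pi_Qmax p + _]Qmax_addE (Qmax_mulE r p) (Qmax_mulE r q) !Qmax_mulE.
rewrite [RHS]Qmax_addE.
have [rD _] := qb_hom r.
symmetry; apply: Qmax_eq_dom => /=.
- by move=> x [[px rx] [qx r'x]].
- move=> x [[px rx] [qx r'x]]; split=> //.
  by have [[_ ID _] _] := qJ_dense r; apply: ID.
- by [].
- by move=> x [[px rx] [qx r'x]]; rewrite rD.
Qed.

HB.instance Definition _ := GRing.Zmodule_isPzRing.Build Qmax
  Qmax_mulA Qmax_mul1 Qmax_mulr1 Qmax_mulDl Qmax_mulDr.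

Definition Qmax_inj (r : R) : Qmax := \pi_Qmax (qpair_of r).

Lemma Qmax_inj_is_zmod_morphism : zmod_morphism Qmax_inj.
Proof.
move=> x y; rewrite /Qmax_inj [X in _ = _ + X]Qmax_oppE [RHS]Qmax_addE.
apply: Qmax_eq_dom => //= z _; by rewrite (mulrBr, mulrBl).
Qed.

Lemma Qmax_inj_is_monoid_morphism : monoid_morphism Qmax_inj.
Proof.
split=> // x y; rewrite /Qmax_inj [RHS]Qmax_mulE.
by apply: Qmax_eq_dom => //= z _; rewrite mulrA.
Qed.

HB.instance Definition _ :=
  GRing.isZmodMorphism.Build R Qmax Qmax_inj Qmax_inj_is_zmod_morphism.
HB.instance Definition _ :=
  GRing.isMonoidMorphism.Build R Qmax Qmax_inj Qmax_inj_is_monoid_morphism.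

Lemma Qmax_inj_injective : injective Qmax_inj.
Proof.
move=> x y /Qmax_eqP[[K [dK _ eK]] _]; apply/subr0_eq.
by apply: (dense_left_faithful dK) => i /eK /= ixy; rewrite mulrBr ixy subrr.
Qed.

End Qmax.

(******************************************************************************)
(*  The tensor product of a right module M and a left module N, presented by  *)
(*  generators and relations: a list of pairs stands for the sum of the       *)
(*  corresponding pure tensors, and concatenation is addition.  The opposite  *)
(*  of the tensor of m and n is that of -m and n.                             *)
(******************************************************************************)

Section Tensor.
Variables (R : pzRingType) (M : lmodType R^c) (N : lmodType R).
Implicit Types (s t : seq (M * N)) (m : M) (n : N).

Inductive tens_eqv : seq (M * N) -> seq (M * N) -> Prop :=
| tens_refl s : tens_eqv s s
| tens_sym s t : tens_eqv s t -> tens_eqv t s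
| tens_trans s t u : tens_eqv s t -> tens_eqv t u -> tens_eqv s u
| tens_cat s s' t t' : tens_eqv s s' -> tens_eqv t t' ->
    tens_eqv (s ++ t) (s' ++ t')
| tens_catC s t : tens_eqv (s ++ t) (t ++ s)
| tens_0l n : tens_eqv [:: (0, n)] [::]
| tens_Dl m m' n : tens_eqv [:: (m + m', n)] [:: (m, n); (m', n)]
| tens_Dr m n n' : tens_eqv [:: (m, n + n')] [:: (m, n); (m, n')]
| tens_M m (r : R) n : tens_eqv [:: ((r : R^c) *: m, n)] [:: (m, r *: n)].

Definition tens_rel s t : bool := `[< tens_eqv s t >].

Lemma tens_rel_refl : reflexive tens_rel.
Proof. by move=> s; apply/asboolP; exact: tens_refl. Qed.

Lemma tens_rel_sym : symmetric tens_rel.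
Proof. by move=> s t; apply/asboolP/asboolP; exact: tens_sym. Qed.

Lemma tens_rel_trans : transitive tens_rel.
Proof.
by move=> t s u /asboolP st /asboolP tu; apply/asboolP; exact: tens_trans tu.
Qed.

Canonical tens_equiv := EquivRel tens_rel tens_rel_refl tens_rel_sym tens_rel_trans.

Definition tensor := {eq_quot tens_rel}.
HB.instance Definition _ := Choice.on tensor.
HB.instance Definition _ := EqQuotient.on tensor.

Lemma tensor_eqP s t : tens_eqv s t <-> \pi_tensor s = \pi_tensor t.
Proof.
split=> [h|/eqP]; first by apply/eqmodP/asboolP.
by rewrite piE => /asboolP.
Qed.

Definition tens_opp s : seq (M * N) := [seq (- p.1, p.2) | p <- s].

Definition tensor_zero : tensor := \pi_tensor [::].
Definition tensor_add (u v : tensor) : tensor := \pi_tensor (repr u ++ repr v).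
Definition tensor_opp (u : tensor) : tensor := \pi_tensor (tens_opp (repr u)).

Lemma tensor_addE s t :
  tensor_add (\pi_tensor s) (\pi_tensor t) = \pi_tensor (s ++ t).
Proof. by apply/tensor_eqP/tens_cat; apply/tensor_eqP; rewrite reprK. Qed.

Lemma tensor_addA : associative tensor_add.
Proof.
elim/quotW=> s; elim/quotW=> t; elim/quotW=> u.
by rewrite (tensor_addE t u) (tensor_addE s t) !tensor_addE catA.
Qed.

Lemma tensor_addC : commutative tensor_add.
Proof.
elim/quotW=> s; elim/quotW=> t; rewrite !tensor_addE; apply/tensor_eqP.
exact: tens_catC.
Qed.

Lemma tensor_add0 : left_id tensor_zero tensor_add.
Proof. by elim/quotW=> s; rewrite /tensor_zero tensor_addE. Qed.

Lemma tens_addN s : tens_eqv (tens_opp s ++ s) [::].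
Proof.
elim: s => [|[m n] s IHs] /=; first exact: tens_refl.
apply: (@tens_trans _ ([:: (- m, n)] ++ ([:: (m, n)] ++ (tens_opp s ++ s)))).
  apply: (@tens_cat [:: (- m, n)] [:: (- m, n)]); first exact: tens_refl.
  rewrite -cat1s !catA; apply: tens_cat; last exact: tens_refl.
  exact: tens_catC.
apply: (@tens_cat [:: (- m, n); (m, n)] [::] _ [::]) IHs.
apply: tens_trans (tens_0l n).
by rewrite -(addNr m); apply: tens_sym; exact: tens_Dl.
Qed.

Lemma tensor_addN : left_inverse tensor_zero tensor_opp tensor_add.
Proof.
elim/quotW=> s; rewrite -{2}[\pi_tensor s]reprK tensor_addE.
by apply/tensor_eqP; exact: tens_addN.
Qed.

HB.instance Definition _ :=
  GRing.isZmodule.Build tensor tensor_addA tensor_addC tensor_add0 tensor_addN.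

Definition pure_tensor m n : tensor := \pi_tensor [:: (m, n)].

Lemma pure_tensorDl m m' n :
  pure_tensor (m + m') n = pure_tensor m n + pure_tensor m' n.
Proof. by rewrite [RHS]tensor_addE; apply/tensor_eqP/tens_Dl. Qed.

Lemma pure_tensorDr m n n' :
  pure_tensor m (n + n') = pure_tensor m n + pure_tensor m n'.
Proof. by rewrite [RHS]tensor_addE; apply/tensor_eqP/tens_Dr. Qed.

Lemma pure_tensorM m (r : R) n :
  pure_tensor ((r : R^c) *: m) n = pure_tensor m (r *: n).
Proof. by apply/tensor_eqP/tens_M. Qed.

Lemma tensorE s : \pi_tensor s = \sum_(p <- s) pure_tensor p.1 p.2.
Proof.
elim: s => [|[m n] s IHs]; rewrite ?big_nil ?big_cons //= -IHs.
by rewrite [RHS]tensor_addE.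
Qed.

End Tensor.

Section TensorMaps.
Variable R : pzRingType.

Definition tensor_map (M M' : lmodType R^c) (N N' : lmodType R)
    (f : {linear M -> M'}) (g : {linear N -> N'}) (u : tensor M N) :
  tensor M' N' := \sum_(p <- repr u) pure_tensor (f p.1) (g p.2).

Lemma tensor_mapE (M M' : lmodType R^c) (N N' : lmodType R)
    (f : {linear M -> M'}) (g : {linear N -> N'}) (s : seq (M * N)) :
  tensor_map f g (\sum_(p <- s) pure_tensor p.1 p.2) =
  \sum_(p <- s) pure_tensor (f p.1) (g p.2).
Proof.
rewrite -tensorE /tensor_map.
have : tens_eqv (repr (\pi_(tensor M N) s)) s.
  by apply/tensor_eqP; rewrite reprK.
move: (repr _) => t; elim=> {s t}.
- by [].
- by [].
- by move=> s t u _ -> _ ->.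
- by move=> s s' t t' _ IHs _ IHt; rewrite !big_cat /= IHs IHt.
- by move=> s t; rewrite !big_cat /= addrC.
- move=> n; rewrite big_seq1 big_nil /= linear0.
  by apply: (addIr (pure_tensor 0 (g n))); rewrite -pure_tensorDl !add0r.
- by move=> m m' n; rewrite !big_cons !big_nil !addr0 /= linearD pure_tensorDl.
- by move=> m n n'; rewrite !big_cons !big_nil !addr0 /= linearD pure_tensorDr.
- by move=> m r n; rewrite !big_seq1 /= !linearZ /= pure_tensorM.
Qed.

Definition flat_left (N : lmodType R) :=
  forall (M M' : lmodType R^c) (f : {linear M -> M'}),
    injective f -> injective (tensor_map f (idfun : {linear N -> N})).

Definition flat_right (M : lmodType R^c) :=
  forall (N N' : lmodType R) (g : {linear N -> N'}),
    injective g -> injective (tensor_map (idfun : {linear M -> M}) g).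

End TensorMaps.

Section RestrictionOfScalars.
Variables (R S : pzRingType) (f : {rmorphism R -> S}).

Definition left_restr of {rmorphism R -> S} : Type := S.
Definition right_restr of {rmorphism R -> S} : Type := S.

HB.instance Definition _ := GRing.Zmodule.copy (left_restr f) S.
HB.instance Definition _ := GRing.Zmodule.copy (right_restr f) S.

Definition left_restr_scale (r : R) (s : left_restr f) : left_restr f :=
  (f r * s : S).
Definition right_restr_scale (r : R^c) (s : right_restr f) : right_restr f :=
  (s * f r : S).

Fact left_restrA a b v :
  left_restr_scale a (left_restr_scale b v) = left_restr_scale (a * b) v.
Proof. by rewrite /left_restr_scale rmorphM mulrA. Qed.
Fact left_restr1 : left_id 1 left_restr_scale.
Proof. by move=> v; rewrite /left_restr_scale rmorph1 mul1r. Qed.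
Fact left_restrDr : right_distributive left_restr_scale +%R.
Proof. by move=> a u v; exact: mulrDr. Qed.
Fact left_restrDl v : {morph left_restr_scale^~ v : a b / a + b}.
Proof. by move=> a b; rewrite /left_restr_scale rmorphD mulrDl. Qed.

HB.instance Definition _ := GRing.Zmodule_isLmodule.Build R (left_restr f)
  left_restrA left_restr1 left_restrDr left_restrDl.

Fact right_restrA a b v :
  right_restr_scale a (right_restr_scale b v) = right_restr_scale (a * b) v.
Proof. by rewrite /right_restr_scale [f (a * b)](rmorphM f b a) mulrA. Qed.
Fact right_restr1 : left_id 1 right_restr_scale.
Proof. by move=> v; rewrite /right_restr_scale [f 1](rmorph1 f) mulr1. Qed.
Fact right_restrDr : right_distributive right_restr_scale +%R.
Proof. by move=> a u v; exact: mulrDl. Qed.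
Fact right_restrDl v : {morph right_restr_scale^~ v : a b / a + b}.
Proof. by move=> a b; rewrite /right_restr_scale [f (a + b)](rmorphD f) mulrDr. Qed.

HB.instance Definition _ := GRing.Zmodule_isLmodule.Build R^c (right_restr f)
  right_restrA right_restr1 right_restrDr right_restrDl.

End RestrictionOfScalars.

Definition ring_epi (R S : pzRingType) (f : {rmorphism R -> S}) :=
  forall (T : pzRingType) (g h : {rmorphism S -> T}),
    g \o f =1 h \o f -> g =1 h.

Definition flat_epi (R S : pzRingType) (f : {rmorphism R -> S}) :=
  [/\ ring_epi f, flat_left (left_restr f) & flat_right (right_restr f)].

Section SubringType.
Variables (T : pzRingType) (S : subringClosed T).

Definition subring_of := {x : T | x \in S}.
HB.instance Definition _ := SubChoice.on subring_of.
HB.instance Definition _ :=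
  GRing.SubChoice_isSubPzRing.Build T _ subring_of (GRing.subringClosedP S).

Variables (R : pzRingType) (f : {rmorphism R -> T}) (fS : forall r, f r \in S).

Definition corestr (r : R) : subring_of := Sub (f r) (fS r).

Lemma corestr_is_zmod_morphism : zmod_morphism corestr.
Proof. by move=> x y; apply: val_inj; rewrite /= rmorphB. Qed.

Lemma corestr_is_monoid_morphism : monoid_morphism corestr.
Proof. by split=> [|x y]; apply: val_inj; rewrite /= (rmorph1, rmorphM). Qed.

HB.instance Definition _ :=
  GRing.isZmodMorphism.Build R subring_of corestr corestr_is_zmod_morphism.
HB.instance Definition _ :=
  GRing.isMonoidMorphism.Build R subring_of corestr corestr_is_monoid_morphism.

End SubringType.

(* The subrings S of Q^sigma_max(R) containing R such that R -> S is a ring   *)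
(* epimorphism with S flat on both sides; Q^sigma_tot(R) is the largest one.  *)
Definition flat_epi_subring (R : pzRingType) (S : subringClosed (Qmax R)) :=
  exists RS : forall r, @Qmax_inj R r \in S, flat_epi (corestr RS).

Definition is_Qtot (R : pzRingType) (A : set (Qmax R)) :=
  (exists S : subringClosed (Qmax R), flat_epi_subring S /\ A = [set` S]) /\
  (forall S : subringClosed (Qmax R), flat_epi_subring S -> [set` S] `<=` A).

(* An ordinal is given by a strictly well-ordered type of that order type.    *)
Record ord := Ord {
  ord_sort :> Type;
  ord_lt : ord_sort -> ord_sort -> Prop;
  ord_lt_wf : well_founded ord_lt;
  ord_lt_trans : forall x y z, ord_lt x y -> ord_lt y z -> ord_lt x z;
  ord_lt_total : forall x y, [\/ ord_lt x y, x = y | ord_lt y x] }.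

Definition osucc_lt (g : ord) (x y : option g) : Prop :=
  match x, y with
  | Some x, Some y => ord_lt x y
  | Some _, None => True
  | None, _ => False
  end.

Definition osucc (g : ord) : ord.
Proof.
refine (@Ord (option g) (@osucc_lt g) _ _ _).
- have H (x : g) : Acc (@osucc_lt g) (Some x).
    elim: (ord_lt_wf x) => {}x _ IHx.
    by constructor=> -[y /= yx|//]; exact: IHx.
  by move=> [x|]; [exact: H | constructor=> -[y _|//]; exact: H].
- by move=> [x|] [y|] [z|] //=; exact: ord_lt_trans.
- move=> [x|] [y|] /=.
  + case: (ord_lt_total x y) => [?|->|?];
      by [constructor 1|constructor 2|constructor 3].
  + by constructor 1.
  + by constructor 3.
  + by constructor 2.
Defined.

Lemma ord_irr (g : ord) (x : g) : ~ ord_lt x x.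
Proof. by elim: (ord_lt_wf x) => {}x _ IHx xx; exact: (IHx x). Qed.

Definition osegment (g : ord) (x : g) : ord.
Proof.
refine (@Ord {y : g | `[< ord_lt y x >]}
             (fun y z => ord_lt (val y) (val z)) _ _ _).
- move=> u; move: {2}(val u) (erefl (val u)) => y.
  elim: (ord_lt_wf y) u => {}y _ IHy u uy.
  by constructor=> v; rewrite uy => vy; exact: (IHy (val v)).
- by move=> u v w; exact: ord_lt_trans.
- move=> u v; case: (ord_lt_total (val u) (val v)) => [uv|/val_inj uv|uv];
    by [constructor 1|constructor 2|constructor 3].
Defined.

Section Iteration.
Variables (T : Type) (F : set T -> set T) (A : set T).

Section Along.
Variable g : ord.
Implicit Types x y : g.

Definition ord_isO x := forall y, ~ ord_lt y x.
Definition ord_isS y x := ord_lt y x /\ forall z, ord_lt y z -> ~ ord_lt z x.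
Definition ord_islim x := ~ ord_isO x /\ forall y, ~ ord_isS y x.

(* For x in a well-ordered type, the x-th iterate of F starting from A, with  *)
(* intersections at the limits; x stands for the ordinal of all y < x.        *)
Definition iterates : g -> set T :=
  Fix (@ord_lt_wf g) (fun=> set T) (fun x it t =>
    [\/ ord_isO x /\ A t,
        exists y (yx : ord_lt y x), ord_isS y x /\ F (it y yx) t
      | ord_islim x /\ forall y (yx : ord_lt y x), it y yx t]).

Lemma iteratesE x : iterates x = (fun t =>
    [\/ ord_isO x /\ A t,
        exists y (yx : ord_lt y x), ord_isS y x /\ F (iterates y) t
      | ord_islim x /\ forall y (yx : ord_lt y x), iterates y t]).
Proof.
rewrite {1}/iterates Fix_eq //= => y f h fh.
suff -> : f = h by [].
by apply/functional_extensionality_dep => z; apply/functional_extensionality_dep.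
Qed.

Lemma iteratesO x : ord_isO x -> iterates x = A.
Proof.
move=> x0; rewrite iteratesE; apply/seteqP; split=> t; last by constructor 1.
by case=> [[]//|[y [yx _]]|[[]//]]; have := x0 _ yx.
Qed.

Lemma iteratesS y x : ord_isS y x -> iterates x = F (iterates y).
Proof.
move=> xS; rewrite iteratesE; apply/seteqP; split=> t; last first.
  by move=> Ft; constructor 2; exists y; have [yx _] := xS; exists yx.
case=> [[x0]|[z [zx [[_ Hz] Fz]]]|[[_ /(_ y)]//]].
  by have [/x0] := xS.
suff -> : y = z by [].
have [yx Hy] := xS.
by case: (ord_lt_total y z) => // [/Hy|/Hz] /(_ _) //.
Qed.

Lemma iterates_lim x : ord_islim x ->
  iterates x = \bigcap_(y in [set y | ord_lt y x]) iterates y.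
Proof.
move=> xl; rewrite iteratesE; apply/seteqP; split=> t; last by constructor 3.
by case: xl => x0 xS; case=> [[]//|[y [_ [/xS]]]//|[_ h] y /= /h].
Qed.

End Along.

(* The iterates only depend on the initial segments.                          *)
Lemma iterates_embed (g h : ord) (e : g -> h) :
  (forall x y, ord_lt (e x) (e y) <-> ord_lt x y) ->
  (forall x z, ord_lt z (e x) -> exists y, z = e y) ->
  forall x, iterates (e x) = iterates x.
Proof.
move=> emono einit x; elim: (ord_lt_wf x) => {}x _ IHx.
rewrite !iteratesE; apply/funext => t.
have isO : ord_isO (e x) = ord_isO x.
  apply/propext; split=> xO y; first by move=> yx; apply: (xO (e y)); apply/emono.
  by move=> yx; have [z zy] := einit x y yx; subst y; move/emono: yx; exact: xO.
have isS y : ord_isS (e y) (e x) = ord_isS y x.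
  apply/propext; split=> -[yx xS]; split; try exact/emono.
    by move=> z yz zx; apply: (xS (e z)); apply/emono.
  move=> z yz zx; have [w zw] := einit x z zx; subst z.
  by move/emono: yz => /xS; apply; apply/emono.
have islim : ord_islim (e x) = ord_islim x.
  rewrite /ord_islim isO; apply/propext; split=> -[xO xS]; split=> // y.
    by rewrite -isS; exact: xS.
  move=> yS; have [yx _] := yS; have [z yz] := einit x y yx; subst y.
  by apply: (xS z); rewrite -isS.
rewrite isO islim; apply/propext; split.
- case=> [?|[y [yx [yS Ft]]]|[xl xt]]; first by constructor 1.
    have [z yz] := einit x y yx; subst y; move/emono: (yx) => zx.
    by constructor 2; exists z, zx; rewrite -isS -IHx.
  constructor 3; split=> // y yx; rewrite -IHx //.
  by apply: xt; apply/emono.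
- case=> [?|[y [yx [yS Ft]]]|[xl xt]]; first by constructor 1.
    constructor 2; exists (e y); exists (proj2 (emono _ _) yx).
    by rewrite isS IHx.
  constructor 3; split=> // y yx; have [z yz] := einit x y yx; subst y.
  by move/emono: yx => zx; rewrite IHx //; exact: xt.
Qed.

(* The iterate indexed by the ordinal g itself, i.e. by the top of g + 1.     *)
Definition iterate (g : ord) : set T := @iterates (osucc g) None.

Lemma iterates_Some (g : ord) (x : g) :
  @iterates (osucc g) (Some x) = iterates x.
Proof.
apply: (@iterates_embed g (osucc g) Some) => // {}x [z|[]] _; by exists z.
Qed.

Lemma iterate_segment (g : ord) (x : g) : iterate (osegment x) = iterates x.
Proof.
pose e (y : osucc (osegment x)) : g := if y is Some y then val y else x.
apply/esym; apply: (@iterates_embed (osucc (osegment x)) g e _ _ None).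
- move=> [[y /asboolP yx]|] [[z /asboolP zx]|] //=; split=> //.
  + by move=> xz; have := @ord_irr g _ (ord_lt_trans xz zx).
  + by move=> xx; have := @ord_irr g _ xx.
- move=> y z zy; have zx : ord_lt z x.
    by case: y zy => [[y /asboolP yx]|] //= zy; exact: ord_lt_trans zy yx.
  by exists (Some (exist _ z (asboolT zx))).
Qed.

Lemma iterate0 (g : ord) : (g -> False) -> iterate g = A.
Proof. by move=> g0; apply: iteratesO => -[y _|[]]; exact: g0 y. Qed.

Lemma iterate_succ (g : ord) : iterate (osucc g) = F (iterate g).
Proof.
rewrite /iterate -(@iterates_Some (osucc g) None).
by apply: iteratesS; split=> // -[[z|]|] //= _; case.
Qed.

Lemma iterate_lim (g : ord) : inhabited g ->
  (forall x : g, exists y, ord_lt x y) ->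
  iterate g = \bigcap_(x in [set: g]) iterate (osegment x).
Proof.
under eq_bigcapr do rewrite iterate_segment.
move=> [x0] glim; rewrite /iterate iterates_lim; last first.
  split; first by move/(_ (Some x0)); exact.
  move=> [x|] [xN h]; last by case: xN.
  by have [y xy] := glim x; exact: (h (Some y) xy I).
apply/seteqP; split=> t h.
  by move=> x _; rewrite -iterates_Some; exact: h.
by move=> [x _|[]]; rewrite iterates_Some; exact: h.
Qed.

End Iteration.

Section Derived.
Variables (R T : pzRingType) (f : {rmorphism R -> T}).
Implicit Types (A B S : set T) (s : T).

(* Finite sums of products, as usual for products of additive subgroups.      *)
Definition set_mul A B : set T :=
  [set t | exists2 u : seq (T * T),
     (forall p, p \in u -> A p.1 /\ B p.2) & t = \sum_(p <- u) p.1 * p.2].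

Definition left_den s : set T := [set x | range f x /\ range f (x * s)].
Definition right_den s : set T := [set x | range f x /\ range f (s * x)].

(* The ring S' of an extension S of R inside T, R being identified with its   *)
(* image under f.                                                             *)
Definition derived S : set T :=
  [set s | S s /\ forall r, set_mul S (left_den (f r * s)) = S /\
                            set_mul (right_den (s * f r)) S = S].

End Derived.

(* Q^(g) for Q := Q^sigma_max(R).                                             *)
Definition Qder (R : pzRingType) (g : ord) : set (Qmax R) :=
  iterate (derived (@Qmax_inj R)) [set: Qmax R] g.

Arguments Qder : clear implicits.

(* Main.v *)
From HB Require Import structures.
Require Import Defs.
From mathcomp Require Import all_boot all_algebra.
From mathcomp Require Import boolp classical_sets functions wochoice.

Set Implicit Arguments.
Unset Strict Implicit.
Unset Printing Implicit Defensive.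

Import GRing.Theory.

Local Open Scope ring_scope.
Local Open Scope classical_set_scope.
Local Open Scope quotient_scope.

(** Let [S] be a ring extension of [R].  The extension is an epimorphism making
[S] a flat left [R]-module if and only if [(s : R) S = S] for every [s] in [S]:
each element of [S] is carried into [R] by a right ideal of [R] that generates
[S].  The same holds on the other side, by passing to opposite rings.  So the
condition that selects the elements of [S'] holds throughout [S] exactly when
[S] is a flat epimorphic extension of [R], and the fixed points of the
derivation among the subrings of [Q] are the flat epimorphic ones
([derived_fixpoint_flat_epi]).  Moreover, if [U] is such a subring and [U] is
contained in [S], then an equation writing 1 as an element of [(u : R) U] also
writes 1 as an element of [(u : R) S], so [U] is contained in [S']
([flat_epi_subring_derived]).  By transfinite induction every [Q^(g)] is a
subring containing [R] and all flat epimorphic subrings; when it is a fixed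
point it is itself flat epimorphic, hence the largest one.  A fixed point exists
because a decreasing family of subsets of [Q] cannot be injective on a
well-ordered set with more elements than there are subsets of [Q]
([iterate_stabilizes]).

Suppose that [(s : R) S = S] for all [s].  The right ideals [X] of [R] with
[X S = S] are then closed under finite intersections, and finitely many elements
of [S] have common denominators forming such an [X].  Multiplying a tensor of
elements [m_k] of a right module [M] and [b_k] of [S] by a common denominator
[x] of the [b_k] gives the element [\sum_k m_k (b_k x)] of [M]; these elements,
for [x] in some [X] as above, determine the tensor because 1 is in [X S].  Thus
the equality of two tensors is a condition inside [M], which injections of
modules reflect: [S] is flat ([flat_left_den]).

Conversely, if [R -> S] is an epimorphism then the tensors of [b] and 1 and of
1 and [b] coincide in the tensor square of [S] ([epi_tensor]).  If [S] is flat,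
they already coincide in the tensor product of [b R + R] and [S].  Sending the
tensor of [b r + r'] and [s] to the class of [r s] modulo [(b : R) S] is well
defined and maps these two tensors to the classes of 1 and 0, so that 1 is in
[(b : R) S] ([flat_epi_den]). *)

(** * Tensor products and opposite rings *)

Lemma tensor_mapE_pi (R : pzRingType) (M M' : lmodType R^c) (N N' : lmodType R)
    (f : {linear M -> M'}) (g : {linear N -> N'}) (s : seq (M * N)) :
  tensor_map f g (\pi_(tensor M N) s) =
  \pi_(tensor M' N') [seq (f p.1, g p.2) | p <- s].
Proof. by rewrite !tensorE tensor_mapE big_map. Qed.

Lemma tensor_map_injP (R : pzRingType) (M M' : lmodType R^c)
    (N N' : lmodType R) (f : {linear M -> M'}) (g : {linear N -> N'}) :
  injective (tensor_map f g) <->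
  forall s t : seq (M * N),
    tens_eqv [seq (f p.1, g p.2) | p <- s] [seq (f p.1, g p.2) | p <- t] ->
    tens_eqv s t.
Proof.
split=> [inj s t st|inj].
  by apply/tensor_eqP/inj; rewrite !tensor_mapE_pi; apply/tensor_eqP.
elim/quotW=> s; elim/quotW=> t; rewrite !tensor_mapE_pi => /tensor_eqP st.
exact/tensor_eqP/inj.
Qed.

(** Over the opposite ring the two factors of a tensor product trade places.
The scalars are transported by a function [tau] because a ring and its double
opposite are different structures on the same set. *)
Lemma tens_eqv_swap (A B : pzRingType) (M : lmodType A^c) (N : lmodType A)
    (M' : lmodType B^c) (N' : lmodType B)
    (i : {additive M -> N'}) (j : {additive N -> M'}) (tau : A -> B) :
  (forall (a : A) m, i ((a : A^c) *: m) = tau a *: i m) ->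
  (forall a n, j (a *: n) = (tau a : B^c) *: j n) ->
  forall s t : seq (M * N), tens_eqv s t ->
  tens_eqv [seq (j p.2, i p.1) | p <- s] [seq (j p.2, i p.1) | p <- t].
Proof.
move=> iZ jZ s t; elim=> {s t} /=.
- by move=> s; exact: tens_refl.
- by move=> s t _; exact: tens_sym.
- by move=> s t u _ + _; exact: tens_trans.
- by move=> s s' t t' _ ss' _ tt'; rewrite !map_cat; exact: tens_cat.
- by move=> s t; rewrite !map_cat; exact: tens_catC.
- move=> n; rewrite raddf0.
  apply: (@tens_trans _ _ _ _ [:: ((0 : B^c) *: j n, 0)]); last first.
    by rewrite scale0r; exact: tens_0l.
  by apply: tens_sym; rewrite -[X in tens_eqv _ [:: (_, X)]](scale0r 0);
     exact: tens_M.
- by move=> m m' n; rewrite raddfD; exact: tens_Dr.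
- by move=> m n n'; rewrite raddfD; exact: tens_Dl.
- by move=> m r n; rewrite iZ jZ; apply: tens_sym; exact: tens_M.
Qed.

Section ScalarRestriction.
Variables (A B : pzRingType) (h : {rmorphism A -> B}) (N : lmodType B).

Definition restr_mod of {rmorphism A -> B} : Type := N.
HB.instance Definition _ := GRing.Zmodule.on (restr_mod h).

Definition restr_scale (a : A) (n : restr_mod h) : restr_mod h :=
  h a *: (n : N).

Fact restr_scaleA a b v :
  restr_scale a (restr_scale b v) = restr_scale (a * b) v.
Proof. by rewrite /restr_scale rmorphM scalerA. Qed.
Fact restr_scale1 : left_id 1 restr_scale.
Proof. by move=> v; rewrite /restr_scale rmorph1 scale1r. Qed.
Fact restr_scaleDr : right_distributive restr_scale +%R.
Proof. by move=> a u v; exact: scalerDr. Qed.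
Fact restr_scaleDl v : {morph restr_scale^~ v : a b / a + b}.
Proof. by move=> a b; rewrite /restr_scale rmorphD scalerDl. Qed.

HB.instance Definition _ := GRing.Zmodule_isLmodule.Build A (restr_mod h)
  restr_scaleA restr_scale1 restr_scaleDr restr_scaleDl.

Definition to_restr : {additive N -> restr_mod h} := idfun.
Definition of_restr : {additive restr_mod h -> N} := idfun.

Lemma of_restrZ a n : of_restr (a *: n) = h a *: of_restr n.
Proof. by []. Qed.

End ScalarRestriction.
Arguments to_restr {A B} h N.
Arguments of_restr {A B} h N.

Section RestrictedMap.
Variables (A B : pzRingType) (h : {rmorphism A -> B}) (N N' : lmodType B).
Variable g : {linear N -> N'}.

Definition restr_map : restr_mod N h -> restr_mod N' h := g.

Lemma restr_map_linear : linear restr_map.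
Proof. by move=> a x y; exact: linearP. Qed.
HB.instance Definition _ := GRing.isLinear.Build A _ _ _ restr_map
  restr_map_linear.

End RestrictedMap.
Arguments restr_map {A B} h {N N'} g.

Section DoubleOpposite.
Variable R : pzRingType.

Definition to_opop_fun (r : R) : R^c^c := r.
Definition of_opop_fun (r : R^c^c) : R := r.

Fact to_opop_zmod : zmod_morphism to_opop_fun. Proof. by []. Qed.
Fact to_opop_monoid : monoid_morphism to_opop_fun. Proof. by []. Qed.
Fact of_opop_zmod : zmod_morphism of_opop_fun. Proof. by []. Qed.
Fact of_opop_monoid : monoid_morphism of_opop_fun. Proof. by []. Qed.

HB.instance Definition _ :=
  GRing.isZmodMorphism.Build R R^c^c to_opop_fun to_opop_zmod.
HB.instance Definition _ :=
  GRing.isMonoidMorphism.Build R R^c^c to_opop_fun to_opop_monoid.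
HB.instance Definition _ :=
  GRing.isZmodMorphism.Build R^c^c R of_opop_fun of_opop_zmod.
HB.instance Definition _ :=
  GRing.isMonoidMorphism.Build R^c^c R of_opop_fun of_opop_monoid.

Definition to_opop : {rmorphism R -> R^c^c} := to_opop_fun.
Definition of_opop : {rmorphism R^c^c -> R} := of_opop_fun.

End DoubleOpposite.

Section OppositeMorphism.
Variables (R S : pzRingType) (f : {rmorphism R -> S}).

Definition opmor_fun (r : R^c) : S^c := f r.

Fact opmor_zmod : zmod_morphism opmor_fun.
Proof. by move=> x y; exact: (rmorphB f). Qed.
Fact opmor_monoid : monoid_morphism opmor_fun.
Proof. by split=> [|x y]; [exact: (rmorph1 f)|exact: (rmorphM f)]. Qed.

HB.instance Definition _ := GRing.isZmodMorphism.Build R^c S^c opmor_fun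
    opmor_zmod.
HB.instance Definition _ :=
  GRing.isMonoidMorphism.Build R^c S^c opmor_fun opmor_monoid.

Definition opmor : {rmorphism R^c -> S^c} := opmor_fun.

(* The two modules have the same elements and the same action of [R], but they
are different structures: hence the explicit identity maps. *)
Definition to_left_op (x : right_restr f) : left_restr opmor := x.
Definition of_left_op (x : left_restr opmor) : right_restr f := x.
Fact to_left_op_zmod : zmod_morphism to_left_op. Proof. by []. Qed.
Fact of_left_op_zmod : zmod_morphism of_left_op. Proof. by []. Qed.
HB.instance Definition _ :=
  GRing.isZmodMorphism.Build _ _ to_left_op to_left_op_zmod.
HB.instance Definition _ :=
  GRing.isZmodMorphism.Build _ _ of_left_op of_left_op_zmod.

End OppositeMorphism.
Arguments opmor {R S} f.

Lemma ring_epi_op (R S : pzRingType) (f : {rmorphism R -> S}) :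
  ring_epi f -> ring_epi (opmor f).
Proof.
move=> f_epi T g h gh x.
exact: (f_epi T^c (opmor g \o @to_opop S) (opmor h \o @to_opop S) gh x).
Qed.

Section FlatOpposite.
Variables (R S : pzRingType) (f : {rmorphism R -> S}).

Lemma to_left_opZ (a : R) (m : right_restr f) :
  to_left_op ((a : R^c) *: m) = (a : R^c) *: to_left_op m.
Proof. by []. Qed.

(** Exchanging the factors turns an injection of right modules over the
opposite ring into an injection of left [R]-modules; the same holds with the
roles of the two rings exchanged in [flat_right_op]. *)
Lemma flat_left_op :
  flat_right (right_restr f) -> flat_left (left_restr (opmor f)).
Proof.
move=> fl M M' h h_inj; apply/tensor_map_injP => s t st.
have /tensor_map_injP fi :=
  fl _ _ (restr_map (@to_opop R) h : {linear _ -> _}) h_inj.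
have := @tens_eqv_swap R^c R M' (left_restr (opmor f)) (right_restr f)
  (restr_mod M' (@to_opop R)) (to_restr (@to_opop R) M') (@of_left_op _ _ f)
  id (fun _ _ => erefl) (fun _ _ => erefl) _ _ st.
rewrite -!map_comp => st'.
have := fi [seq (of_left_op p.2, to_restr (@to_opop R) M p.1) | p <- s]
  [seq (of_left_op p.2, to_restr (@to_opop R) M p.1) | p <- t].
rewrite -!map_comp => /(_ st') st''.
have := @tens_eqv_swap R R^c (right_restr f) (restr_mod M (@to_opop R))
  M (left_restr (opmor f)) (@to_left_op _ _ f) (of_restr (@to_opop R) M) id
  to_left_opZ (@of_restrZ _ _ (@to_opop R) M) _ _ st''.
by rewrite -!map_comp !map_id_in // => -[].
Qed.

Lemma flat_right_op :
  flat_left (left_restr (opmor f)) -> flat_right (right_restr f).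
Proof.
move=> fl N N' h h_inj; apply/tensor_map_injP => s t st.
have /tensor_map_injP fi :=
  fl _ _ (restr_map (@of_opop R) h : {linear _ -> _}) h_inj.
have := @tens_eqv_swap R R^c (right_restr f) N' (restr_mod N' (@of_opop R))
  (left_restr (opmor f)) (@to_left_op _ _ f) (to_restr (@of_opop R) N')
  id (fun _ _ => erefl) (fun _ _ => erefl) _ _ st.
rewrite -!map_comp => st'.
have := fi [seq (to_restr (@of_opop R) N p.2, to_left_op p.1) | p <- s]
  [seq (to_restr (@of_opop R) N p.2, to_left_op p.1) | p <- t].
rewrite -!map_comp => /(_ st') st''.
have := @tens_eqv_swap R^c R (restr_mod N (@of_opop R))
  (left_restr (opmor f)) (right_restr f) N (of_restr (@of_opop R) N)
  (@of_left_op _ _ f) id (fun _ _ => erefl) (fun _ _ => erefl) _ _ st''.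
by rewrite -!map_comp !map_id_in // => -[].
Qed.

End FlatOpposite.

(** * Ideals of denominators and flatness *)

Section SetMul.
Variable T : pzRingType.
Implicit Types A B C X Z G : set T.

Lemma set_mul_ind A B G : G 0 -> (forall x y, G x -> G y -> G (x + y)) ->
  (forall a b, A a -> B b -> G (a * b)) -> set_mul A B `<=` G.
Proof.
move=> G0 GD GM _ [u uAB ->]; rewrite big_seq.
by apply: (big_ind G) => // p /uAB[? ?]; exact: GM.
Qed.

Lemma set_mul0 A B : set_mul A B 0.
Proof. by exists [::]; rewrite ?big_nil. Qed.

Lemma set_mulD A B x y :
  set_mul A B x -> set_mul A B y -> set_mul A B (x + y).
Proof.
move=> [u uAB ->] [v vAB ->]; exists (u ++ v); last by rewrite big_cat.
by move=> p; rewrite mem_cat => /orP[/uAB|/vAB].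
Qed.

Lemma set_mul_in A B a b : A a -> B b -> set_mul A B (a * b).
Proof.
move=> Aa Bb; exists [:: (a, b)]; last by rewrite big_seq1.
by move=> p; rewrite inE => /eqP->.
Qed.

Lemma set_mulS A A' B B' :
  A `<=` A' -> B `<=` B' -> set_mul A B `<=` set_mul A' B'.
Proof.
move=> sA sB; apply: set_mul_ind; [exact: set_mul0|exact: set_mulD|].
by move=> a b /sA A'a /sB B'b; exact: set_mul_in.
Qed.

(** A sum of elements [x c] equal to 1 is expanded by replacing each [x c] with
[x 1 c] and the middle 1 with a sum of elements [y d], where [y] may depend on
[x].  Denominators are thus chosen one after the other and multiplied, instead
of being intersected. *)
Lemma set_mul1_trans C X Z : (forall c d, C c -> C d -> C (c * d)) ->
  set_mul X C 1 -> (forall x, X x -> set_mul [set y | Z (x * y)] C 1) ->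
  set_mul Z C 1.
Proof.
move=> CM X1 XZ.
apply: set_mul_ind X1; [exact: set_mul0|exact: set_mulD|] => x c Xx Cc.
rewrite -[x]mulr1; apply: (@set_mul_ind _ _ [set t | set_mul Z C (x * t * c)]
    _ _ _ _ (XZ x Xx)) => /= [|t u Zt Zu|y d Zy Cd].
- by rewrite mulr0 mul0r; exact: set_mul0.
- by rewrite mulrDr mulrDl; exact: set_mulD.
- by rewrite mulrA -mulrA; apply: set_mul_in => //; exact: CM.
Qed.

End SetMul.

Section Denominators.
Variables (R S : pzRingType) (f : {rmorphism R -> S}).
Implicit Types X Y : set S.

Lemma rangeD x y : range f x -> range f y -> range f (x + y).
Proof. by move=> [a _ <-] [b _ <-]; exists (a + b); rewrite ?rmorphD. Qed.
Lemma rangeN x : range f x -> range f (- x).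
Proof. by move=> [a _ <-]; exists (- a); rewrite ?rmorphN. Qed.
Lemma rangeM x y : range f x -> range f y -> range f (x * y).
Proof. by move=> [a _ <-] [b _ <-]; exists (a * b); rewrite ?rmorphM. Qed.
Lemma range_in r : range f (f r). Proof. by exists r. Qed.
Lemma range0 : range f 0. Proof. by exists 0; rewrite ?rmorph0. Qed.
Lemma range1 : range f 1. Proof. by exists 1; rewrite ?rmorph1. Qed.

(** The right ideals of [R], seen in [S], that generate the unit right ideal
of [S]: they play the part of a Gabriel topology. *)
Definition unit_right_ideal X :=
  [/\ X `<=` range f, X 0, forall x y, X x -> X y -> X (x + y),
      forall x y, X x -> range f y -> X (x * y) & set_mul X setT 1].

Hypothesis fracS : forall s, set_mul (right_den f s) setT 1.

Definition common_den (B : seq S) : set S :=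
  [set x | range f x /\ forall b, b \in B -> range f (b * x)].

(** Once [x] is a common denominator of [B], a denominator [y] of [b x] makes
[x y] a common denominator of [b] and [B]. *)
Lemma unit_common_den B : unit_right_ideal (common_den B).
Proof.
split=> [x []//||x y [Rx Bx] [Ry By]|x y [Rx Bx] Ry|].
- by split=> [|b _]; rewrite ?mulr0; exact: range0.
- split=> [|b Bb]; first exact: rangeD.
  by rewrite mulrDr; apply: rangeD; [exact: Bx|exact: By].
- split=> [|b Bb]; first exact: rangeM.
  by rewrite mulrA; apply: rangeM => //; exact: Bx.
elim: B => [|b B IHB].
  by rewrite -[X in set_mul _ _ X]mulr1; apply: set_mul_in => //; split=> //;
     exact: range1.
apply: set_mul1_trans IHB _ => // x [Rx Bx].
apply: set_mulS (fracS (b * x)) => // y [Ry bxy].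
split=> /= [|c]; first exact: rangeM.
rewrite inE mulrA => /predU1P[->//|/Bx cx]; exact: rangeM.
Qed.

(** If [1 = \sum_j y_j d_j] with [y_j] in [X], then
[x z = \sum_j y_j (d_j x z)] is in [X] for every common denominator [z] of the
[d_j x]. *)
Lemma unit_quotient X x : unit_right_ideal X -> range f x ->
  set_mul [set y | range f y /\ X (x * y)] setT 1.
Proof.
move=> [XR X0 XD XM [u uX u1]] Rx.
have [_ _ _ _] := unit_common_den [seq p.2 * x | p <- u].
apply: set_mulS => // z [Rz Bz]; split=> //.
rewrite -[x]mul1r u1 !mulr_suml big_seq.
apply: (big_ind X) => // p pu; have [Xp _] := uX p pu.
by rewrite -!mulrA; apply: XM => //; rewrite mulrA; apply: Bz; exact: map_f.
Qed.

Lemma unitI X Y : unit_right_ideal X -> unit_right_ideal Y ->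
  unit_right_ideal (X `&` Y).
Proof.
move=> uX uY; have [XR X0 XD XM X1] := uX; have [YR Y0 YD YM _] := uY.
split=> [x [/XR]//||x y [? ?] [? ?]|x y [? ?] ?|]; first by split.
- by split; [exact: XD|exact: YD].
- by split; [exact: XM|exact: YM].
apply: set_mul1_trans X1 _ => // x Xx.
apply: set_mulS (unit_quotient uY (XR x Xx)) => // y [Ry Yxy].
by split=> //; exact: XM.
Qed.

(** The filter generated by the unit right ideals; it spares checking that the
sets of interest are themselves right ideals. *)
Definition unit_near (P : S -> Prop) :=
  exists2 X, unit_right_ideal X & X `<=` P.

Lemma unit_near_and (P P' : S -> Prop) :
  unit_near P -> unit_near P' -> unit_near (fun x => P x /\ P' x).
Proof.
move=> [X uX XP] [Y uY YP]; exists (X `&` Y); first exact: unitI.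
by move=> x [/XP ? /YP].
Qed.

Lemma unit_nearS (P P' : S -> Prop) :
  (forall x, P x -> P' x) -> unit_near P -> unit_near P'.
Proof. by move=> PP' [X uX XP]; exists X => // x /XP/PP'. Qed.

Hypothesis f_inj : injective f.

Definition inv_range (x : S) : R := xget 0 [set r | f r = x].

Lemma inv_rangeK x : range f x -> f (inv_range x) = x.
Proof.
by move=> [r _ rx]; apply: (xgetPex 0 (P := [set r | f r = x])); exists r.
Qed.

Lemma inv_rangeE r : inv_range (f r) = r.
Proof. by apply: f_inj; rewrite inv_rangeK //; exact: range_in. Qed.

Lemma inv_rangeD x y : range f x -> range f y ->
  inv_range (x + y) = inv_range x + inv_range y.
Proof. by move=> [a _ <-] [b _ <-]; rewrite -rmorphD !inv_rangeE. Qed.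

Lemma inv_rangeM x y : range f x -> range f y ->
  inv_range (x * y) = inv_range x * inv_range y.
Proof. by move=> [a _ <-] [b _ <-]; rewrite -rmorphM !inv_rangeE. Qed.

Section Flatness.
Variable M : lmodType R^c.
Local Notation S_R := (left_restr f).
Implicit Types s t : seq (M * S_R).

(** For a common denominator [x] of the [b_k], the product by [x] of the tensor
of the [m_k] and [b_k], brought back to [M]. *)
Definition clear_den s (x : S) : M :=
  \sum_(p <- s) (inv_range ((p.2 : S) * x) : R^c) *: p.1.

Definition clears s (x : S) := range f x /\
  forall p, p \in s -> range f ((p.2 : S) * x).

Lemma unit_near_clears s : unit_near (clears s).
Proof.
exists (common_den [seq (p.2 : S) | p <- s]); first exact: unit_common_den.
by move=> x [Rx sx]; split=> // p ps; apply: sx; exact: (map_f (@snd _ _)).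
Qed.

Lemma clears_cat s t x : clears (s ++ t) x <-> clears s x /\ clears t x.
Proof.
split=> [[Rx st]|[[Rx sx] [_ tx]]].
  by split; split=> // p ps; apply: st; rewrite mem_cat ps ?orbT.
by split=> // p; rewrite mem_cat => /orP[/sx|/tx].
Qed.

Lemma clear_den_cat s t x :
  clear_den (s ++ t) x = clear_den s x + clear_den t x.
Proof. exact: big_cat. Qed.

(** Only the defining relations of the tensor product have to be considered,
each on its own unit ideal: a chain of relations is handled by intersecting
finitely many of them. *)
Lemma tens_eqv_clear s t : tens_eqv s t ->
  unit_near (fun x =>
    [/\ clears s x, clears t x & clear_den s x = clear_den t x]).
Proof.
elim=> {s t}.
- by move=> s; apply: unit_nearS (unit_near_clears s).
- by move=> s t _; apply: unit_nearS => x [].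
- move=> s t u _ /unit_near_and H _ /H.
  by apply: unit_nearS => x [[sx tx ->] [_ ux ->]].
- move=> s s' t t' _ /unit_near_and H _ /H.
  apply: unit_nearS => x [[sx s'x es] [tx t'x et]].
  by split; [exact/clears_cat|exact/clears_cat|rewrite !clear_den_cat es et].
- move=> s t; apply: unit_nearS (unit_near_clears (s ++ t)) => x stx.
  split=> //; last by rewrite !clear_den_cat addrC.
  by apply/clears_cat; rewrite and_comm; exact/clears_cat.
- move=> n; apply: unit_nearS (unit_near_clears [:: (0, n)]) => x [Rx nx].
  by split=> //; rewrite /clear_den big_seq1 big_nil scaler0.
- move=> m m' n; apply: unit_nearS (unit_near_clears [:: (m, n)]) => x [Rx nx].
  have {}nx : range f ((n : S) * x) by apply: (nx (m, n)); rewrite inE.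
  split; last by rewrite /clear_den !big_cons !big_nil /= !addr0 scalerDr.
    by split=> // p; rewrite inE => /eqP->.
  by split=> // p; rewrite !inE => /orP[]/eqP->.
- move=> m n n'.
  apply: unit_nearS (unit_near_clears [:: (m, n); (m, n')]) => x [Rx nx].
  have nxr : range f ((n : S) * x) by apply: (nx (m, n)); rewrite inE eqxx.
  have n'xr : range f ((n' : S) * x).
    by apply: (nx (m, n')); rewrite !inE eqxx orbT.
  split=> //.
    split=> // p; rewrite inE => /eqP-> /=.
    by rewrite (mulrDl (n : S)); exact: rangeD.
  rewrite /clear_den !big_cons !big_nil /= !addr0.
  by rewrite (mulrDl (n : S)) inv_rangeD // scalerDl.
- move=> m r n; apply: unit_nearS (unit_near_clears [:: (m, n)]) => x [Rx nx].
  have {}nx : range f ((n : S) * x) by apply: (nx (m, n)); rewrite inE.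
  split.
  + by split=> // p; rewrite inE => /eqP->.
  + split=> // p; rewrite inE => /eqP-> /=.
    by rewrite -(mulrA (f r) n); apply: rangeM => //; exact: range_in.
  + rewrite /clear_den !big_seq1 /= -(mulrA (f r) n).
    rewrite (inv_rangeM (range_in r) nx) inv_rangeE.
    by rewrite scalerA.
Qed.

Definition act_right s (c : S) : tensor M S_R :=
  \sum_(p <- s) pure_tensor p.1 ((p.2 : S) * c : S_R).

Lemma act_right1 s : act_right s 1 = \pi_(tensor M S_R) s.
Proof. by rewrite tensorE; apply: eq_bigr => p _; rewrite mulr1. Qed.

Lemma act_rightD s c d : act_right s (c + d) = act_right s c + act_right s d.
Proof.
rewrite -big_split; apply: eq_bigr => p _ /=.
by rewrite (mulrDr (p.2 : S)) [LHS]pure_tensorDr.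
Qed.

Lemma pure_tensor0l (n : S_R) : pure_tensor (0 : M) n = 0.
Proof.
by apply: (addIr (pure_tensor (0 : M) n)); rewrite -pure_tensorDl !add0r.
Qed.

Lemma act_rightM s x c : clears s x ->
  act_right s (x * c) = pure_tensor (clear_den s x) (c : S_R).
Proof.
rewrite /act_right /clear_den => -[Rx]; elim: s => [|p s IHs] sx.
  by rewrite !big_nil pure_tensor0l.
rewrite !big_cons pure_tensorDl -IHs => [|q qs]; last first.
  by apply: sx; rewrite inE qs orbT.
congr (_ + _); rewrite pure_tensorM; congr pure_tensor.
by rewrite mulrA -[in LHS](inv_rangeK (sx p _)) // inE eqxx.
Qed.

(** Writing 1 as a sum of elements [x c] with [x] in the unit ideal, the tensor
is the sum of its products by the [x c], which [clear_den] determines. *)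
Lemma clear_tensor s t :
  unit_near (fun x =>
    [/\ clears s x, clears t x & clear_den s x = clear_den t x]) ->
  tens_eqv s t.
Proof.
move=> [X [_ _ _ _ X1] Xst]; apply/tensor_eqP; rewrite -!act_right1.
have A0 u : act_right u 0 = 0.
  by apply: (addIr (act_right u 0)); rewrite -act_rightD !add0r.
apply: (@set_mul_ind _ _ _ [set c | act_right s c = act_right t c] _ _ _ _ X1)
  => /= [|c d sc sd|x c /Xst[sx tx xst] _]; first by rewrite !A0.
- by rewrite !act_rightD sc sd.
- by rewrite !act_rightM // xst.
Qed.

End Flatness.

(** By [tens_eqv_clear] and [clear_tensor] the equality of tensors is a
condition on elements of the module, which an injection reflects. *)
Lemma flat_left_den : flat_left (left_restr f).
Proof.
move=> M M' h h_inj; apply/tensor_map_injP => s t /tens_eqv_clear st.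
apply: clear_tensor; apply: unit_nearS st => x.
have clearsE (u : seq (M * left_restr f)) :
    clears [seq (h p.1, idfun p.2) | p <- u] x -> clears u x.
  move=> [Rx ux]; split=> // p pu.
  exact: (ux _ (map_f (fun p => (h p.1, idfun p.2)) pu)).
have clearE (u : seq (M * left_restr f)) :
    clear_den [seq (h p.1, idfun p.2) | p <- u] x = h (clear_den u x).
  rewrite /clear_den big_map linear_sum; apply: eq_bigr => p _.
  by rewrite linearZ.
by move=> [/clearsE ? /clearsE ?]; rewrite !clearE => /h_inj.
Qed.

(** If [x] and [b x] come from [R], then
[g b * h (x c) = g (b x) * h c = h (b x) * h c = h b * h (x c)]; and 1 is a sum
of such elements [x c]. *)
Lemma ring_epi_den : ring_epi f.
Proof.
move=> T g h gh b; rewrite -[g b]mulr1 -[h b]mulr1 -(rmorph1 h).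
apply: (@set_mul_ind _ _ _ [set c | g b * h c = h b * h c] _ _ _ _ (fracS b))
  => /= [|c d bc bd|x c [[r _ rx] [r' _ r'x]] _].
- by rewrite rmorph0 !mulr0.
- by rewrite rmorphD !mulrDr bc bd.
have gx : h x = g x by rewrite -rx; exact/esym/gh.
rewrite rmorphM !mulrA; congr (_ * _).
by rewrite {1}gx -!rmorphM -r'x; exact: gh.
Qed.

End Denominators.

(** * Endomorphisms of an abelian group *)

Section AdditiveEndomorphisms.
Variable W : zmodType.

Definition additive_pred : {pred W -> W} := fun f => `[< zmod_morphism f >].

Fact additive_zmod_closed : zmod_closed additive_pred.
Proof.
split=> [|f g /asboolP fB /asboolP gB]; apply/asboolP => x y /=.
  by rewrite subrr.
rewrite -[LHS]/(f (x - y) - g (x - y)) fB gB.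
by rewrite opprD addrACA -opprD.
Qed.

(** The ring in which the epimorphism property is tested. *)
Definition additive_end := {f : W -> W | f \in additive_pred}.
HB.instance Definition _ := SubChoice.on additive_end.
HB.instance Definition _ := GRing.SubChoice_isSubZmodule.Build (W -> W)
  additive_pred additive_end additive_zmod_closed.

Definition end_fun (f : additive_end) : W -> W := val f.

Fact end_fun_zmod (f : additive_end) : zmod_morphism (end_fun f).
Proof. by apply/asboolP; exact: (valP f). Qed.
HB.instance Definition _ (f : additive_end) :=
  GRing.isZmodMorphism.Build W W (end_fun f) (end_fun_zmod f).

Fact id_additive : idfun \in additive_pred.
Proof. exact/asboolP. Qed.

Fact comp_additive (f g : additive_end) :
  end_fun f \o end_fun g \in additive_pred.
Proof. by apply/asboolP => x y; rewrite /= !raddfB. Qed.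

Definition end_one : additive_end := Sub idfun id_additive.
Definition end_mul (f g : additive_end) : additive_end :=
  Sub (end_fun f \o end_fun g) (comp_additive f g).

Fact end_mulA : associative end_mul.
Proof. by move=> f g h; apply: val_inj. Qed.
Fact end_mul1 : left_id end_one end_mul.
Proof. by move=> f; apply: val_inj. Qed.
Fact end_mulr1 : right_id end_one end_mul.
Proof. by move=> f; apply: val_inj. Qed.
Fact end_mulDl : left_distributive end_mul +%R.
Proof. by move=> f g h; apply: val_inj. Qed.
Fact end_mulDr : right_distributive end_mul +%R.
Proof.
move=> f g h; apply: val_inj; apply/funext => x /=.
exact: (raddfD (end_fun f)).
Qed.

HB.instance Definition _ := GRing.Zmodule_isPzRing.Build additive_end
  end_mulA end_mul1 end_mulr1 end_mulDl end_mulDr.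

End AdditiveEndomorphisms.

(** * Denominators of a flat epimorphism *)

Lemma subrACA (V : zmodType) (a b c d : V) : a - b - (c - d) = a - c - (b - d).
Proof. by rewrite opprD addrACA -opprD. Qed.

Section Tensors.
Variable R : pzRingType.

Fact tensor_map_zmod (M M' : lmodType R^c) (N N' : lmodType R)
    (f : {linear M -> M'}) (g : {linear N -> N'}) :
  zmod_morphism (tensor_map f g).
Proof.
have tD u v : tensor_map f g (u + v) = tensor_map f g u + tensor_map f g v.
  elim/quotW: u => s; elim/quotW: v => t.
  rewrite [X in tensor_map _ _ X]tensor_addE !tensor_mapE_pi [RHS]tensor_addE.
  by rewrite map_cat.
move=> u v; apply: (addIr (tensor_map f g v)).
by rewrite -tD !subrK.
Qed.
HB.instance Definition _ (M M' : lmodType R^c) (N N' : lmodType R)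
    (f : {linear M -> M'}) (g : {linear N -> N'}) :=
  GRing.isZmodMorphism.Build _ _ (tensor_map f g) (tensor_map_zmod f g).

Lemma tensor_map_pure (M M' : lmodType R^c) (N N' : lmodType R)
    (f : {linear M -> M'}) (g : {linear N -> N'}) m n :
  tensor_map f g (pure_tensor m n) = pure_tensor (f m) (g n).
Proof. exact: tensor_mapE_pi. Qed.

End Tensors.

Section Epi.
Variables (R S : pzRingType) (f : {rmorphism R -> S}).

Let SS := tensor (right_restr f) (left_restr f).

Definition lmul (s : S) (x : right_restr f) : right_restr f := s * (x : S).

Fact lmul_linear s : linear (lmul s).
Proof.
move=> r x y; rewrite /lmul [LHS]mulrDr; congr (_ + _).
exact: mulrA.
Qed.
HB.instance Definition _ s :=
  GRing.isLinear.Build R^c _ _ _ (lmul s) (lmul_linear s).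

Definition tmul (s : S) : SS -> SS :=
  tensor_map (lmul s : {linear _ -> _}) (idfun : {linear _ -> left_restr f}).
HB.instance Definition _ s :=
  GRing.isZmodMorphism.Build SS SS (tmul s) (tensor_map_zmod _ _).

Lemma tmul_pure s x y : tmul s (pure_tensor x y) = pure_tensor (lmul s x) y.
Proof. exact: tensor_map_pure. Qed.

Lemma tensor_ind (P : SS -> Prop) : P 0 ->
  (forall u v, P u -> P v -> P (u + v)) ->
  (forall x y, P (pure_tensor x y)) -> forall u, P u.
Proof.
by move=> P0 PD Pp; elim/quotW=> s; rewrite tensorE; apply: big_ind.
Qed.

Lemma tmulM s t u : tmul (s * t) u = tmul s (tmul t u).
Proof.
elim/tensor_ind: u => [|u v su sv|x y]; first by rewrite !raddf0.
  by rewrite !raddfD /= su sv.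
by rewrite !tmul_pure /lmul mulrA.
Qed.

Lemma tmulB s t u : tmul (s - t) u = tmul s u - tmul t u.
Proof.
elim/tensor_ind: u => [|u v su sv|x y]; first by rewrite !raddf0 addr0.
  by rewrite !raddfD /= su sv addrACA.
rewrite !tmul_pure; apply: (addIr (pure_tensor (lmul t x) y)).
by rewrite -pure_tensorDl subrK /lmul mulrBl subrK.
Qed.

Lemma tmul1 u : tmul 1 u = u.
Proof.
elim/tensor_ind: u => [|u v su sv|x y]; first by rewrite !raddf0.
  by rewrite !raddfD /= su sv.
by rewrite !tmul_pure /lmul mul1r.
Qed.

Section Action.
Variable theta : {additive S -> SS}.

(** Left multiplication on the product of [S] and its tensor square, conjugated
by the automorphism [(x, u) |-> (x, u + theta x)]. *)
Definition twisted (s : S) (p : S * SS) : S * SS :=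
  (s * p.1, tmul s (p.2 - theta p.1) + theta (s * p.1)).

Fact twisted_additive s : twisted s \in @additive_pred (S * SS)%type.
Proof.
apply/asboolP => -[x u] [y v]; apply: injective_projections => /=.
  exact: mulrBr.
rewrite [in LHS](raddfB theta) subrACA (raddfB (tmul s)) mulrBr (raddfB theta).
by rewrite opprD addrACA.
Qed.

Definition twisted_end (s : S) : additive_end (S * SS)%type :=
  Sub (twisted s) (twisted_additive s).

Fact twisted_end_zmod : zmod_morphism twisted_end.
Proof.
move=> s t; apply: val_inj; apply/funext => -[x u];
  apply: injective_projections => /=.
  exact: mulrBl.
by rewrite tmulB mulrBl (raddfB theta) opprD addrACA.
Qed.

Fact twisted_end_monoid : monoid_morphism twisted_end.
Proof.
split=> [|s t]; apply: val_inj; apply/funext => -[x u];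
  apply: injective_projections => /=.
- exact: mul1r.
- by rewrite tmul1 mul1r subrK.
- by rewrite mulrA.
- by rewrite addrK tmulM mulrA.
Qed.

HB.instance Definition _ := GRing.isZmodMorphism.Build S
  (additive_end (S * SS)%type) twisted_end twisted_end_zmod.
HB.instance Definition _ := GRing.isMonoidMorphism.Build S
  (additive_end (S * SS)%type) twisted_end twisted_end_monoid.

End Action.

(** The map [theta] sending [x] to the tensor of 1 and [x] is left [R]-linear,
so the action of [S] twisted by [theta] and the untwisted one agree on [R],
hence on [S]: [theta] is left [S]-linear and [theta b = b * theta 1]. *)
Lemma epi_tensor : ring_epi f ->
  forall b : S, pure_tensor (b : right_restr f) (1 : left_restr f) =
                pure_tensor (1 : right_restr f) (b : left_restr f).
Proof.
move=> f_epi b.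
pose theta_fun (x : S) : SS :=
  pure_tensor (1 : right_restr f) (x : left_restr f).
have theta_zmod : zmod_morphism theta_fun.
  move=> x y; apply: (addIr (theta_fun y)).
  by rewrite -[LHS]pure_tensorDr !subrK.
pose thetaM := GRing.isZmodMorphism.Build S SS theta_fun theta_zmod.
pose theta : {additive S -> SS} := HB.pack theta_fun thetaM.
have /(_ b) : twisted_end theta =1 twisted_end \0.
  apply: f_epi => r; apply: val_inj; apply/funext => -[x u];
  apply: injective_projections => //=.
  have theta_lin : tmul (f r) (theta x) = theta (f r * x).
    rewrite [in LHS]/theta /= tmul_pure /lmul mulr1 -[X in pure_tensor X]mul1r.
    exact: pure_tensorM.
  rewrite (raddfB (tmul (f r))) /= [X in _ - X + _]theta_lin.
  by rewrite subrK subr0 addr0.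
move=> /(congr1 (fun e => (end_fun e (1, 0)).2)) /=.
rewrite mulr1 sub0r oppr0 !addr0 [tmul b 0]raddf0 (raddfN (tmul b)) addrC.
by move/subr0_eq; rewrite /theta_fun /= tmul_pure /lmul mulr1 => <-.
Qed.
End Epi.

Section FlatDenominators.
Variables (R S : pzRingType) (f : {rmorphism R -> S}) (b : S).

(** The right [R]-submodule of [S] generated by [1] and [b]. *)
Definition frac_pred : {pred right_restr f} :=
  fun x => `[< exists r : R, range f ((x : S) - b * f r) >].

Fact frac_submod_closed : GRing.subsemimod_closed frac_pred.
Proof.
split.
  split.
    by apply/asboolP; exists 0; rewrite rmorph0 mulr0 subrr; exact: range0.
  move=> x y /asboolP[r xr] /asboolP[r' yr']; apply/asboolP; exists (r + r').
  by rewrite rmorphD mulrDr opprD addrACA; exact: rangeD.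
move=> a x /asboolP[r xr]; apply/asboolP; exists (r * a).
rewrite rmorphM mulrA -[X in range f X]mulrBl; exact: rangeM.
Qed.

Definition frac_mod := {x : right_restr f | x \in frac_pred}.
HB.instance Definition _ := SubChoice.on frac_mod.
HB.instance Definition _ := GRing.SubChoice_isSubLmodule.Build R^c
  (right_restr f) frac_pred frac_mod frac_submod_closed.

Definition frac_num (x : frac_mod) : R :=
  xget 0 [set r | range f ((val x : S) - b * f r)].

Lemma frac_numP x : range f ((val x : S) - b * f (frac_num x)).
Proof.
have /asboolP xP := valP x.
exact: (xgetPex 0 (P := [set r | range f ((val x : S) - b * f r)])).
Qed.

(** The choice of [r] such that [x] is in [b r + R] does not matter modulo
[(b : R)], which makes the pairing below well defined modulo [I]. *)
Lemma frac_num_den x r : range f ((val x : S) - b * f r) ->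
  right_den f b (f (frac_num x) - f r).
Proof.
move=> xr; split; first by rewrite -rmorphB; exact: range_in.
have -> : b * (f (frac_num x) - f r) =
    ((val x : S) - b * f r) - ((val x : S) - b * f (frac_num x)).
  by rewrite subrACA subrr sub0r opprB mulrBr.
by apply: rangeD => //; apply: rangeN; exact: frac_numP.
Qed.

Local Notation I := (set_mul (right_den f b) setT).

Lemma den_idealN x : I x -> I (- x).
Proof.
apply: (@set_mul_ind _ _ _ [set x | I (- x)]) => /= [|y z Iy Iz|a c Aa _].
- by rewrite oppr0; exact: set_mul0.
- by rewrite opprD; exact: set_mulD.
- by rewrite -mulrN; exact: set_mul_in.
Qed.

(** On [b r + r'] and [s] this is [r s], modulo [I]. *)
Definition frac_pairing (s : seq (frac_mod * left_restr f)) : S :=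
  \sum_(p <- s) f (frac_num p.1) * (p.2 : S).

Lemma tens_eqv_pairing s t :
  tens_eqv s t -> I (frac_pairing s - frac_pairing t).
Proof.
rewrite /frac_pairing; elim=> {s t}.
- by move=> s; rewrite subrr; exact: set_mul0.
- by move=> s t _ /den_idealN; rewrite opprB.
- by move=> s t u _ st _ /(set_mulD st); rewrite addrA subrK.
- move=> s s' t t' _ ss' _ /(set_mulD ss').
  by rewrite !big_cat /= addrACA -opprD.
- by move=> s t; rewrite !big_cat /= [X in _ - X]addrC subrr; exact: set_mul0.
- move=> n; rewrite big_seq1 big_nil subr0.
  have := @frac_num_den 0 0; rewrite rmorph0 mulr0 !subr0 => h.
  by apply: set_mul_in => //; apply: h; exact: range0.
- move=> m m' n; rewrite !big_cons !big_nil !addr0 /= -mulrDl -mulrBl.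
  apply: set_mul_in => //; rewrite -rmorphD; apply: frac_num_den.
  rewrite rmorphD mulrDr opprD /= addrACA.
  by apply: rangeD; exact: frac_numP.
- move=> m n n'; rewrite !big_cons !big_nil !addr0 /= mulrDr subrr.
  exact: set_mul0.
- move=> m r n; rewrite !big_seq1 /= [X in _ - _ * X]/(f r * n) mulrA -mulrBl.
  apply: set_mul_in => //; rewrite -rmorphM; apply: frac_num_den.
  rewrite rmorphM mulrA -[X in range f X]mulrBl.
  by apply: rangeM; [exact: frac_numP|exact: range_in].
Qed.

(** Modulo [I] the pairing takes the tensors of [b] and 1 and of 1 and [b] to 1
and 0; by flatness these tensors are equal over [b R + R], not only over [S]. *)
Theorem flat_epi_den : ring_epi f -> flat_left (left_restr f) -> I 1.
Proof.
move=> /epi_tensor/(_ b)/tensor_eqP bt fl.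
have bP : (b : right_restr f) \in frac_pred.
  by apply/asboolP; exists 1; rewrite rmorph1 mulr1 subrr; exact: range0.
have oneP : (1 : right_restr f) \in frac_pred.
  by apply/asboolP; exists 0; rewrite rmorph0 mulr0 subr0; exact: range1.
pose mb : frac_mod := Sub (b : right_restr f) bP.
pose m1 : frac_mod := Sub (1 : right_restr f) oneP.
have /tensor_map_injP/(_ [:: (mb, 1)] [:: (m1, b)] bt)/tens_eqv_pairing :=
  fl _ _ (val : {linear frac_mod -> right_restr f}) val_inj.
rewrite /frac_pairing !big_seq1 /= mulr1 => I1.
have Ib : I (1 - f (frac_num mb)).
  rewrite -opprB -[X in - X]mulr1; apply: den_idealN; apply: set_mul_in => //.
  rewrite -(rmorph1 f); apply: frac_num_den.
  by rewrite rmorph1 mulr1 subrr; exact: range0.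
have Ic : I (f (frac_num m1) * b).
  apply: set_mul_in => //; rewrite -[f _]subr0 -(rmorph0 f).
  apply: frac_num_den.
  by rewrite rmorph0 mulr0 subr0; exact: range1.
by have := set_mulD Ib (set_mulD I1 Ic); rewrite subrK subrK.
Qed.

End FlatDenominators.

(** * Transfinite iteration *)

Section Iteration.
Variables (T : Type) (F : set T -> set T) (A : set T).

Lemma iterates_ind (P : set T -> Prop) : P A -> (forall B, P B -> P (F B)) ->
  (forall (I : Type) (D : set I) (B : I -> set T),
     (forall i, D i -> P (B i)) -> P (\bigcap_(i in D) B i)) ->
  forall (g : ord) (x : g), P (iterates F A x).
Proof.
move=> PA PF Pcap g x; elim: (ord_lt_wf x) => {}x _ IHx.
have [xO|xO] := pselect (ord_isO x); first by rewrite iteratesO.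
have [[y yx]|xS] := pselect (exists y, ord_isS y x).
  by rewrite (iteratesS _ _ yx); apply: PF; apply: IHx; case: yx.
rewrite iterates_lim; first exact: Pcap.
by split=> // y yx; apply: xS; exists y.
Qed.

Hypothesis F_sub : forall B, F B `<=` B.

Lemma iterates_decr (g : ord) (x y : g) :
  ord_lt x y -> iterates F A y `<=` iterates F A x.
Proof.
elim: (ord_lt_wf y) x => {}y _ IHy x xy.
have [[z zy]|yS] := pselect (exists z, ord_isS z y); last first.
  rewrite iterates_lim; last first.
    by split=> [yO|z zy]; [exact: (yO x)|apply: yS; exists z].
  by move=> t; exact.
rewrite (iteratesS _ _ zy); move=> t /F_sub; move: t.
have [zy_lt zy_next] := zy.
by case: (ord_lt_total x z) => [|-> //|/zy_next/(_ xy)//]; exact: IHy.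
Qed.

(** The iterate at the successor of [x] lies between the equal iterates at [x]
and at [y]. *)
Lemma iterates_stable (g : ord) (x y : g) :
  ord_lt x y -> iterates F A x = iterates F A y ->
  iterate F A (osegment x) = iterate F A (osucc (osegment x)).
Proof.
move=> xy exy; rewrite iterate_succ iterate_segment.
have [z [xz zmin]] : exists z, ord_lt x z /\
    forall w, ord_lt w z -> ~ ord_lt x w.
  elim: (ord_lt_wf y) (xy) => {exy xy}y _ IHy xy.
  have [[z zy xz]|y_min] := pselect (exists2 z, ord_lt z y & ord_lt x z).
    exact: IHy zy xz.
  by exists y; split=> // w wy xw; apply: y_min; exists w.
have xz_succ : ord_isS x z by split=> // w xw wz; exact: (zmin w).
apply/seteqP; split; last exact: F_sub.
rewrite -(iteratesS F A xz_succ) exy.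
case: (ord_lt_total y z) => [/zmin/(_ xy)//|->//|]; exact: iterates_decr.
Qed.

End Iteration.

Lemma cantor (X : Type) (j : set X -> X) : ~ injective j.
Proof.
move=> j_inj; pose D := [set j B | B in [set B | ~ B (j B)]].
have DE : D (j D) <-> ~ D (j D).
  split=> [[B nB /j_inj BD]|nD]; first by rewrite -BD.
  by exists D.
by have nD : ~ D (j D) by [move=> h; exact: (DE.1 h)]; exact: (nD (DE.2 nD)).
Qed.

(** The strict part of a well-order, as needed to build an ordinal of given
cardinality. *)
Lemma well_order_lt (X : eqType) : exists lt : X -> X -> Prop,
  [/\ well_founded lt, forall x y z, lt x y -> lt y z -> lt x z
    & forall x y, [\/ lt x y, x = y | lt y x]].
Proof.
have [R R_wo] := well_ordering_principle X.
have R_min (B : {pred X}) x : x \in B ->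
    exists2 z, z \in B & {in B, forall y, R z y}.
  move=> Bx; have [|z [[Bz zmin] _]] := R_wo B; first by exists x.
  by exists z.
have R_anti x y : R x y -> R y x -> x = y.
  move=> xy yx; have [|z [_ z_uniq]] := R_wo (pred2 x y).
    by exists x; rewrite inE eqxx.
  have Rxx w : R w w.
    by have [_ /eqP->] := R_min (pred1 w) w (eqxx _); apply; exact: eqxx.
  have minE u v : R u v -> R v u -> pred2 u v =i pred2 x y -> z = u.
    move=> uv vu uvxy; apply: z_uniq; split; first by rewrite -uvxy inE eqxx.
    by move=> w; rewrite -uvxy inE => /pred2P[]->.
  rewrite -(minE x y) // -(minE y x) // => w.
  by rewrite !inE orbC.
pose lt x y := x <> y /\ R x y.
have lt_total x y : [\/ lt x y, x = y | lt y x].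
  have [->|/eqP xy] := eqVneq x y; first by constructor 2.
  have [|_ /pred2P[->|->] zmin] := R_min (pred2 x y) x.
  - by rewrite inE eqxx.
  - by constructor 1; split=> //; apply: zmin; rewrite !inE eqxx orbT.
  - by constructor 3; split=> [/esym//|]; apply: zmin; rewrite !inE eqxx.
have lt_wf : well_founded lt.
  move=> x; apply: contrapT => x_nacc.
  have [|z /asboolP z_nacc zmin] := R_min (fun x => `[< ~ Acc lt x >]) x.
    exact/asboolP.
  apply: z_nacc; constructor=> y [yz Ryz]; apply: contrapT => y_nacc.
  by apply: yz; apply: R_anti Ryz (zmin y _); apply/asboolP.
have lt_trans x y z : lt x y -> lt y z -> lt x z.
  move=> [xy Rxy] [yz Ryz].
  case: (lt_total x z) => [//|xz|[zx Rzx]].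
    by subst z; case: xy; exact: R_anti.
  have [|w wB wmin] := R_min [pred w | [|| w == x, w == y | w == z]] x.
    by rewrite inE eqxx.
  exfalso; move: wB wmin; rewrite inE => /or3P[]/eqP-> wmin.
  - by apply: zx; apply: R_anti => //; apply: wmin; rewrite inE eqxx !orbT.
  - by apply: xy; apply: R_anti => //; apply: wmin; rewrite inE eqxx.
  - by apply: yz; apply: R_anti => //; apply: wmin; rewrite inE eqxx orbT.
by exists lt.
Qed.

(** Along a well-order on the sets of subsets of [T], the iterates cannot all be
distinct by Cantor's theorem, and a repetition makes the sequence constant. *)
Theorem iterate_stabilizes (T : Type) (F : set T -> set T) (A : set T) :
  (forall B, F B `<=` B) ->
  exists g : ord, iterate F A g = iterate F A (osucc g).
Proof.
move=> F_sub.
have [lt [lt_wf lt_trans lt_total]] := well_order_lt (set (set T)).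
pose g : ord := Ord lt_wf lt_trans lt_total.
have [[x [y [xy exy]]]|inj] := pselect (exists x y : g,
    ord_lt x y /\ iterates F A x = iterates F A y).
  by exists (osegment x); exact: iterates_stable exy.
case: (@cantor (set T) (fun B : g => iterates F A B)) => x y exy.
by case: (@ord_lt_total g x y) => // [xy|yx]; case: inj;
  [exists x, y|exists y, x].
Qed.

(** * The derived subring *)

Lemma set_mul_op (T : pzRingType) (A B : set T) :
  @set_mul T^c A B = set_mul B A.
Proof.
apply/seteqP; split.
  apply: (@set_mul_ind T^c _ _ (set_mul B A)) => [|x y|a b Aa Bb];
    [exact: set_mul0|exact: set_mulD|exact: (set_mul_in Bb Aa)].
apply: (@set_mul_ind T _ _ (@set_mul T^c A B)) => [|x y|b a Bb Aa];
  [exact: (@set_mul0 T^c)|exact: (@set_mulD T^c)|exact: (@set_mul_in T^c)].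
Qed.

Definition subring_over (R T : pzRingType) (f : {rmorphism R -> T})
    (S : set T) :=
  [/\ range f `<=` S, forall x y, S x -> S y -> S (x - y)
    & forall x y, S x -> S y -> S (x * y)].

Lemma subring_over_op (R T : pzRingType) (f : {rmorphism R -> T}) (S : set T) :
  subring_over f S -> subring_over (opmor f) S.
Proof. by move=> [fS SB SM]; split=> // x y Sx Sy; exact: SM. Qed.

Section RightDerived.
Variables (R T : pzRingType) (f : {rmorphism R -> T}).
Implicit Types S : set T.

(** One half of the condition defining the derived subring, reduced to the
membership of 1; the other half is the same over the opposite rings. *)
Definition right_derived S : set T :=
  [set s | S s /\ forall r, set_mul (right_den f (s * f r)) S 1].

(** For [s - t], a denominator [a] of [s r] is multiplied by one of [t (r a)];
for [s t], a denominator [a] of [t r], giving [b = t r a] in [R], is multiplied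
by one of [s b]. *)
Lemma right_derived_subring S :
  subring_over f S -> subring_over f (right_derived S).
Proof.
move=> [fS SB SM]; split.
- move=> _ [r _ <-]; split=> [|r']; first exact/fS/range_in.
  rewrite -[X in set_mul _ _ X]mulr1; apply: set_mul_in.
    by split; [exact: range1|rewrite mulr1 -rmorphM; exact: range_in].
  exact/fS/range1.
- move=> s t [Ss sden] [St tden]; split=> [|r]; first exact: SB.
  apply: set_mul1_trans (sden r) _ => // _ [[a _ <-] sra].
  apply: set_mulS (tden (r * a)) => // y [Ry tray]; split.
    by apply: rangeM => //; exact: range_in.
  have -> : (s - t) * f r * (f a * y) = s * f r * f a * y - t * f (r * a) * y.
    by rewrite rmorphM !mulrA !mulrBl.
  by apply: rangeD; [exact: rangeM|exact: rangeN].
- move=> s t [Ss sden] [St tden]; split=> [|r]; first exact: SM.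
  apply: set_mul1_trans (tden r) _ => // _ [[a _ <-] [b _ trab]].
  apply: set_mulS (sden b) => // y [Ry sby]; split.
    by apply: rangeM => //; exact: range_in.
  by move: sby; rewrite trab !mulrA.
Qed.

End RightDerived.

Section Derived.
Variables (R T : pzRingType) (f : {rmorphism R -> T}) (S : set T).
Hypothesis fS : subring_over f S.

(** A one-sided ideal of [S] is [S] as soon as it contains 1. *)
Lemma derivedE : derived f S =
  right_derived f S `&` (right_derived (opmor f) S : set T).
Proof.
have [RS SB SM] := fS.
have S1 : S 1 by apply: RS; exact: range1.
have S0 : S 0 by apply: RS; exact: range0.
have SD x y : S x -> S y -> S (x + y).
  by move=> Sx Sy; rewrite -[y]opprK -[- y]sub0r; apply: (SB) => //; exact: SB.
apply/seteqP; split=> [s [Ss sS]|s [[Ss rS] [_ lS]]].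
  split; split=> // r; have [lS rS] := sS r.
    by rewrite rS.
  by rewrite set_mul_op lS.
split=> // r; split; apply/seteqP; split=> [|t St].
- apply: set_mul_ind => // a b Sa [/RS Sb _]; exact: SM.
- rewrite -[t]mulr1; have := lS r; rewrite set_mul_op.
  apply: (@set_mul_ind _ _ _ [set x | set_mul S (left_den f (f r * s)) (t * x)])
    => /= [|x y tx ty|a b Sa Ab].
  + by rewrite mulr0; exact: set_mul0.
  + by rewrite mulrDr; exact: set_mulD.
  + by rewrite mulrA; apply: set_mul_in => //; exact: SM.
- apply: set_mul_ind => // a b [/RS Sa _] Sb; exact: SM.
- rewrite -[t]mul1r; move: (rS r).
  apply: (@set_mul_ind _ _ _
      [set x | set_mul (right_den f (s * f r)) S (x * t)])
    => /= [|x y tx ty|a b Aa Sb].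
  + by rewrite mul0r; exact: set_mul0.
  + by rewrite mulrDl; exact: set_mulD.
  + by rewrite -mulrA; apply: set_mul_in => //; exact: SM.
Qed.

Lemma derived_subring : subring_over f (derived f S).
Proof.
rewrite derivedE.
have [fr rB rM] := right_derived_subring fS.
have [fl lB lM] := right_derived_subring (subring_over_op fS).
split=> [x Rx|x y [? ?] [? ?]|x y [? ?] [? ?]].
- by split; [exact: fr|exact: fl].
- by split; [exact: rB|exact: lB].
- by split; [exact: rM|exact: lM].
Qed.

End Derived.

(** * Subrings that are flat epimorphic extensions *)

(** The condition on denominators can be read in an extension [U] of [R] or in
any ring containing [U]. *)
Lemma set_mul_den_val (R U T : pzRingType) (phi : {rmorphism R -> U})
    (v : {rmorphism U -> T}) (f : {rmorphism R -> T}) :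
  injective v -> (forall r, v (phi r) = f r) -> forall b,
  set_mul (right_den phi b) setT 1 <->
  set_mul (right_den f (v b)) (range v) 1.
Proof.
move=> v_inj vphi b; split.
  rewrite -(rmorph1 v).
  apply: (@set_mul_ind _ _ _ [set x | set_mul _ _ (v x)])
    => /= [|x y vx vy|_ c [[a _ <-] [r _ br]] _].
  - by rewrite rmorph0; exact: set_mul0.
  - by rewrite rmorphD; exact: set_mulD.
  rewrite rmorphM; apply: set_mul_in; last by exists c.
  by rewrite vphi; split; [exists a|exists r; rewrite // -!vphi -rmorphM -br].
move=> h.
have : [set t | exists2 x, v x = t & set_mul (right_den phi b) setT x] 1.
  move: h; apply: set_mul_ind => [|_ _ [x <- bx] [y <- b_y]|].
  - by exists 0; rewrite ?rmorph0 //; exact: set_mul0.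
  - by exists (x + y); rewrite ?rmorphD //; exact: set_mulD.
  move=> _ _ [[a _ <-] [r _ bar]] [c _ <-].
  exists (phi a * c); first by rewrite rmorphM vphi.
  apply: set_mul_in => //; split; first by exists a.
  by exists r => //; apply: v_inj; rewrite rmorphM !vphi.
by move=> [x v1]; rewrite -(rmorph1 v) in v1; rewrite (v_inj _ _ v1).
Qed.

Section FlatEpiSubrings.
Variable R : pzRingType.
Local Notation f := (@Qmax_inj R).
Implicit Types (S : set (Qmax R)) (U : subringClosed (Qmax R)).

(** The denominators of an element of [U] generate the unit ideal of [U], hence
that of the larger ring [S]. *)
Lemma flat_epi_subring_derived U S : flat_epi_subring U ->
  subring_over f S -> [set` U] `<=` S -> [set` U] `<=` derived f S.
Proof.
move=> [RU [epi fl fr]] fS US; rewrite derivedE // => u Uu.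
pose phi := corestr RU.
have vS : range (val : subring_of U -> Qmax R) `<=` S.
  by move=> _ [x _ <-]; apply: US; exact: (valP x).
split; split=> [|r]; try exact: US.
  have Uur : u * f r \in U by rewrite rpredM.
  have := flat_epi_den (Sub (u * f r) Uur : subring_of U) epi fl.
  move/(@set_mul_den_val _ _ _ phi val f val_inj (fun _ => erefl)).
  exact: set_mulS.
have Uru : f r * u \in U by rewrite rpredM.
have := flat_epi_den (Sub (f r * u) Uru : (subring_of U)^c)
  (ring_epi_op epi) (flat_left_op fr).
move/(@set_mul_den_val _ _ _ (opmor phi) (opmor val) (opmor f) val_inj
  (fun _ => erefl)).
exact: set_mulS.
Qed.

(** For a fixed point the condition on denominators holds for all elements, with
coefficients in [S] itself, and this is what both flatness and the epimorphism
property require. *)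
Lemma derived_fixpoint_flat_epi S : subring_over f S -> derived f S = S ->
  exists U : subringClosed (Qmax R), flat_epi_subring U /\ S = [set` U].
Proof.
move=> fS; have [RS SB SM] := fS => SS.
have S_subring : subring_closed (fun x => `[< S x >] : bool).
  split=> [|x y /asboolP Sx /asboolP Sy|x y /asboolP Sx /asboolP Sy];
    apply/asboolP; [exact/RS/range1|exact: SB|exact: SM].
pose U : subringClosed (Qmax R) :=
  HB.pack (fun x => `[< S x >]) (GRing.isSubringClosed.Build _ _ S_subring).
have SU : S = [set` U] by apply/seteqP; split=> x /asboolP.
exists U; split=> //.
have RU r : f r \in U by apply/asboolP/RS/range_in.
exists RU; pose phi := corestr RU.
have phi_inj : injective phi.
  by move=> x y /(congr1 val) /Qmax_inj_injective.
have vS : S `<=` range (val : subring_of U -> Qmax R).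
  by move=> x /asboolP Sx; exists (Sub x Sx).
rewrite derivedE // in SS.
have rden (b : subring_of U) : set_mul (right_den phi b) setT 1.
  apply/(@set_mul_den_val _ _ _ phi val f val_inj (fun _ => erefl)).
  have : S (val b) by apply/asboolP; exact: (valP b).
  rewrite -{1}SS => -[[_ /(_ 1) +] _].
  by rewrite rmorph1 mulr1; exact: set_mulS.
have lden (b : (subring_of U)^c) : set_mul (right_den (opmor phi) b) setT 1.
  apply/(@set_mul_den_val _ _ _ (opmor phi) (opmor val) (opmor f) val_inj
    (fun _ => erefl)).
  have : S (val b) by apply/asboolP; exact: (valP b).
  rewrite -{1}SS => -[_ [_ /(_ 1) +]].
  by rewrite rmorph1 mulr1; exact: set_mulS.
split; [exact: ring_epi_den|exact: flat_left_den|].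
by apply: flat_right_op; exact: flat_left_den.
Qed.

End FlatEpiSubrings.

Theorem theorem6p1 (R : pzRingType) :
  (exists g : ord, Qder R g = Qder R (osucc g)) /\
  (forall g : ord, Qder R g = Qder R (osucc g) -> is_Qtot (Qder R g)).
Proof.
split=> [|g]; first by apply: iterate_stabilizes => B s [].
rewrite {2}/Qder iterate_succ -/(Qder R g) => fix_g.
pose P S := subring_over (@Qmax_inj R) S /\
  forall U : subringClosed (Qmax R), flat_epi_subring U -> [set` U] `<=` S.
have [Qg_subring Qg_max] : P (Qder R g).
  apply: iterates_ind => [|B [fB UB]|I D B PB]; first by [].
    split=> [|U Uflat]; first exact: derived_subring.
    exact: flat_epi_subring_derived (UB U Uflat).
  split=> [|U Uflat x Ux i Di]; last by have [_ UB] := PB i Di; exact: UB Ux.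
  split=> [_ [r _ <-] i Di|x y Bx By i Di|x y Bx By i Di];
    have [[fB BB BM] _] := PB i Di.
  - exact/fB/range_in.
  - by apply: BB; [exact: Bx|exact: By].
  - by apply: BM; [exact: Bx|exact: By].
split=> //; exact: derived_fixpoint_flat_epi.
Qed.
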